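(* Let $t_0\in\mathbb{R}$, let $\ell_0,\ell_1,f\in V$, let $\sigma\in\Sigma$ and $\ell_0\in V_{t_0}(\sigma)$. Suppose $f(0)(t)=0$ for a.e. $t\le t_0$, and that there exists $\kappa>0$ such that: (i) $f(v)(t)\ge 0$ for a.e. $t\le t_0$ and every $v\in C_0(\mathbb{R};[0,\kappa])$; (ii) $f(v)(t)\,\operatorname{sgn} v(t)\le q(t,\|v\|)$ for a.e. $t\ge t_0$ and every $v\in C_0(\mathbb{R};\mathbb{R})$ with $0\le v(t_0)\le\kappa$ and $-\kappa\le v(t)\le\kappa$ for $t\le t_0$, where $q\in K_{loc}([t_0,+\infty)\times\mathbb{R}_+;\mathbb{R}_+)$ is nondecreasing in the second argument and satisfies $\lim_{x\to+\infty}\frac1x\int_{t_0}^b q(s,x)\,ds=0$ for every $b>t_0$. Let there exist $\gamma\in AC_{loc}((-\infty,t_0];(0,+\infty))$ such that $$\gamma'(t)\le-\ell_1(\gamma)(t)\quad\text{and}\quad \ell_0(1)(t)\ge\frac{\ell_1(\gamma)(t)}{\gamma(t)}\qquad\text{for a.e. }t\le t_0,$$ and $$M_\sigma:=\sup\left\{\int_{\sigma(t)}^t\frac{\ell_1(\gamma)(s)}{\gamma(s)}\,ds:\ t\le t_0\right\}<+\infty.$$ Let, moreover, there exist $g\in L_{loc}(\mathbb{R};\mathbb{R}_+)$ and a continuous nondecreasing function $h_0:(0,+\infty)\to(0,+\infty)$ such that $$f(v)(t)\le g(t)h_0(\|v\|)\quad\text{for a.e. }t\le t_0\text{ and every } v\in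 C_0(\mathbb{R};[0,\kappa]),\ v\not\equiv0,$$ and $\lim_{x\to0_+}\int_x^1\frac{ds}{h_0(s)}=+\infty$. Then, for every $c\in(0,\kappa e^{-M_\sigma}]$, there exists a global solution $u$ to $u'(t)=\ell_0(u)(t)-\ell_1(u)(t)+f(u)(t)$, $u(t_0)=c$, satisfying $0<u(t)\le\kappa$ for $t\le t_0$.
   Context: Notation. $\mathbb{R}_+=[0,+\infty)$. $C_{loc}(\mathbb{R};\mathbb{R})$ is the space of continuous functions $\mathbb{R}\to\mathbb{R}$ with the topology of uniform convergence on every compact interval. $L_{loc}(\mathbb{R};\mathbb{R})$ is the space of locally Lebesgue-integrable functions on $\mathbb{R}$ with the topology of convergence in the mean on every compact interval. For $I,D\subseteq\mathbb{R}$: $C_0(I;D)$ is the set of bounded continuous functions $I\to D$; $AC_{loc}(I;D)$ is the set of functions $I\to D$ absolutely continuous on every compact interval contained in $I$; $L_{loc}(I;\mathbb{R}_+)$ is the set of functions $I\to\mathbb{R}_+$ integrable on every compact interval contained in $I$. $\|v\|=\sup\{|v(t)|:t\in\mathbb{R}\}$. $\operatorname{sgn}$ is the sign function with $\operatorname{sgn}0=0$. $K_{loc}([t_0,+\infty)\times\mathbb{R}_+;\mathbb{R}_+)$ is the set of functions $q:[t_0,+\infty)\times\mathbb{R}_+\to\mathbb{R}_+$ such that $q(\cdot,x)$ is measurable for every $x$, $q(t,\cdot)$ is continuous for a.e. $t$, and for every compact $D\subset\mathbb{R}_+$ the function $\sup\{q(\cdot,x):x\in D\}$ is integrable on every compact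 subinterval of $[t_0,+\infty)$. Standing assumptions. $\ell_0,\ell_1:C_{loc}(\mathbb{R};\mathbb{R})\to L_{loc}(\mathbb{R};\mathbb{R})$ are linear continuous operators which are positive (map non-negative functions to non-negative functions). $f:C_{loc}(\mathbb{R};\mathbb{R})\to L_{loc}(\mathbb{R};\mathbb{R})$ is a continuous operator satisfying the local Carathéodory conditions: for every $r>0$ there is $q_r\in L_{loc}(\mathbb{R};\mathbb{R}_+)$ with $|f(v)(t)|\le q_r(t)$ for a.e. $t\in\mathbb{R}$ whenever $\sup_{\mathbb{R}}|v|\le r$. If $I\subseteq\mathbb{R}$ is a closed interval, $u:I\to\mathbb{R}$ is continuous and $T:C_{loc}(\mathbb{R};\mathbb{R})\to L_{loc}(\mathbb{R};\mathbb{R})$ is a continuous operator, then $T(u):=T(\vartheta(u))$, where $\vartheta(u)$ is the extension of $u$ to $\mathbb{R}$ equal to $u(\inf I)$ to the left of $I$ (if $\inf I>-\infty$) and $u(\sup I)$ to the right of $I$ (if $\sup I<+\infty$). $T(1)$ and $T(0)$ are the values of $T$ at constant functions. For $\tau\in\mathbb{R}$, $V_\tau$ is the set of continuous operators $T:C_{loc}(\mathbb{R};\mathbb{R})\to L_{loc}(\mathbb{R};\mathbb{R})$ such that for every $\zeta\le\tau$, $T(u)(t)=T(v)(t)$ for a.e. $t\le\zeta$ whenever $u,v\in C_{loc}(\mathbb{R};\mathbb{R})$ and $u=v$ on $(-\infty,\zeta]$. $V=\bigcap_{\tau\in\mathbb{R}}V_\tau$. $\Sigma$ is the set of continuous $\sigma:\mathbb{R}\to\mathbb{R}$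 with $\sigma(t)\le t$ for all $t$. For $\sigma\in\Sigma$, $V_\tau(\sigma)$ is the set of continuous operators $T:C_{loc}(\mathbb{R};\mathbb{R})\to L_{loc}(\mathbb{R};\mathbb{R})$ such that, for a.e. $t\le\tau$, $T(u)(t)=T(v)(t)$ whenever $u,v\in C_{loc}(\mathbb{R};\mathbb{R})$ satisfy $u(s)=v(s)$ for $s\in[\sigma(t),t]$. A global solution is a function $u:\mathbb{R}\to\mathbb{R}$ absolutely continuous on every compact interval and satisfying the equation for a.e. $t\in\mathbb{R}$. *)

(* Defs.v *)
From HB Require Import structures.
From mathcomp Require Import all_boot all_order all_algebra.
From mathcomp Require Import all_classical all_reals all_analysis.
Set Implicit Arguments.
Unset Strict Implicit.
Unset Printing Implicit Defensive.
Import Order.TTheory GRing.Theory Num.Theory.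
Import numFieldNormedType.Exports.
Local Open Scope classical_set_scope.
Local Open Scope ring_scope.

(* An operator C_loc(R;R) -> L_loc(R;R) is represented by a map
   T : (R -> R) -> (R -> R). Only its values at continuous functions are
   constrained or used, and T u is a representative of a class modulo equality
   almost everywhere; consequently every condition on T u that the mathematics
   states almost everywhere is stated here for each u (or each pair u, v)
   separately, the exceptional null set being allowed to depend on them.
   lebesgue_measure is defined on the Borel sets: representatives of elements
   of L_loc are taken to be Borel functions, which every class contains. *)

Section operators.
Context {R : realType}.
Let mu := @lebesgue_measure R.
Implicit Types (T : (R -> R) -> R -> R) (u v : R -> R) (I D : set R).

Definition Lloc_nonneg (g : R -> R) : Prop :=
  locally_integrable [set: R] g /\ forall t, 0 <= g t.

Definition continuous_operator T : Prop :=
  (forall u, continuous u -> locally_integrable [set: R] (T u)) /\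
  (forall u, continuous u -> forall a b : R,
    (\int[mu]_(s in `[a, b]) (`|T v s - T u s|%:E))%E
      @[v --> within [set v : R -> R | continuous v]
                     (nbhs (u : {family compact, R -> R}))] --> 0%E).

Definition linear_operator T : Prop :=
  forall (a b : R) u v, continuous u -> continuous v ->
    \forall t \ae mu,
      T (fun s => a * u s + b * v s) t = a * T u t + b * T v t.

Definition positive_operator T : Prop :=
  forall u, continuous u -> (forall t, 0 <= u t) -> \forall t \ae mu, 0 <= T u t.

Definition C0 D : set (R -> R) :=
  [set v | [/\ continuous v, [bounded v t | t in [set: R]] &
               forall t, D (v t)]].

(* Meaningful for bounded functions only: the real-valued sup of an unbounded
   set is 0. *)
Definition supnorm v : R := sup (range (fun t => `|v t|)).

Definition local_caratheodory T : Prop :=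
  forall r : R, 0 < r -> exists2 qr : R -> R, Lloc_nonneg qr &
    forall v, C0 [set: R] v -> supnorm v <= r ->
      \forall t \ae mu, `|T v t| <= qr t.

Definition absolutely_continuous_on (a b : R) u : Prop :=
  forall e : R, 0 < e -> exists2 d : R, 0 < d &
    forall (n : nat) (x y : 'I_n -> R),
      (forall i, [/\ a <= x i, x i < y i & y i <= b]) ->
      trivIset [set: 'I_n] (fun i => `]x i, y i[%classic) ->
      \sum_(i < n) (y i - x i) < d ->
      \sum_(i < n) `|u (y i) - u (x i)| < e.

Definition ACloc I u : Prop :=
  forall a b : R, a <= b -> `[a, b] `<=` I -> absolutely_continuous_on a b u.

(* The extension of u : (-oo, t0] -> R by the constant u(t0). *)
Definition theta (t0 : R) u : R -> R := fun t => u (Num.min t t0).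

Definition V_ (tau : R) T : Prop :=
  continuous_operator T /\
  forall zeta : R, zeta <= tau ->
    forall u v, continuous u -> continuous v ->
      (forall s, s <= zeta -> u s = v s) ->
      \forall t \ae mu, t <= zeta -> T u t = T v t.

Definition V T : Prop := forall tau : R, V_ tau T.

Definition Sigma (sigma : R -> R) : Prop :=
  continuous sigma /\ forall t, sigma t <= t.

Definition V_sigma (tau : R) (sigma : R -> R) T : Prop :=
  continuous_operator T /\
  forall u v, continuous u -> continuous v ->
    \forall t \ae mu, t <= tau ->
      (forall s, sigma t <= s -> s <= t -> u s = v s) -> T u t = T v t.

(* Unlike the elements of L_loc, the functions in K_loc are defined pointwise,
   and their measurability is Lebesgue measurability: coincidence almost
   everywhere with a Borel function. *)
Definition Lebesgue_measurable_fun D u : Prop :=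
  exists2 p : R -> R, measurable_fun D p & u = p %[ae mu in D].

Definition Lebesgue_integrable D u : Prop :=
  exists2 p : R -> R, mu.-integrable D (EFin \o p) & u = p %[ae mu in D].

Definition Kloc (t0 : R) (q : R -> R -> R) : Prop :=
  [/\ forall t x, t0 <= t -> 0 <= x -> 0 <= q t x,
      forall x, 0 <= x -> Lebesgue_measurable_fun `[t0, +oo[ (q ^~ x),
      \forall t \ae mu, t0 <= t -> {within `[0, +oo[, continuous (q t)} &
      forall D, compact D -> D `<=` `[0, +oo[ ->
        forall a b : R, t0 <= a ->
          Lebesgue_integrable `[a, b] (fun t => sup (q t @` D))].

Definition Msigma (t0 : R) (sigma : R -> R) (l1 : (R -> R) -> R -> R)
    (gamma : R -> R) : \bar R :=
  ereal_sup [set (\int[mu]_(s in `[sigma t, t])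
                    (l1 (theta t0 gamma) s / gamma s)%:E)%E
            | t in `]-oo, t0]].

Definition global_solution (l0 l1 f : (R -> R) -> R -> R) u : Prop :=
  ACloc [set: R] u /\
  \forall t \ae mu, is_derive (t : R) (1 : R) u (l0 u t - l1 u t + f u t).

End operators.

(* Main.v *)
(* For t <= t0, solutions that are constant before a point a are limits of
   Tonelli's delayed approximations, whose values at t0 depend continuously on
   that constant, so the value c at t0 is reached by the intermediate value
   theorem. Since gamma' <= - l1 gamma, the quotient u / gamma is nondecreasing,
   whence l1 u <= u * l1 gamma / gamma; as l0 1 >= l1 gamma / gamma, a Gronwall
   argument yields u s <= u t0 * exp M_sigma <= kappa. Now let a tend to -oo: by
   monotonicity of u / gamma, a zero of the limit would force it to vanish on a
   half-line, which it could not leave because of the Osgood condition on h0.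
   For t >= t0, sublinearity of q gives bounds on [t0, t0 + n] valid for every
   solution, and the equation truncated at a continuous level above them is
   solved by the same approximations. Equations are used in integrated form, and
   limits are taken along an ultrafilter on nat instead of subsequences. *)

Require Import Defs.
From mathcomp Require Import all_boot all_order all_algebra.
From mathcomp Require Import all_classical all_reals all_analysis.
From mathcomp Require Import measurable_realfun ring lra.
Import Order.TTheory GRing.Theory Num.Theory.
Import numFieldNormedType.Exports.
Local Open Scope classical_set_scope.
Local Open Scope ring_scope.
Set Implicit Arguments.
Unset Strict Implicit.
Unset Printing Implicit Defensive.

(** The equation is causal, so it gives no way to start at [t0] and go left; and without uniqueness
    the value at [t0] is not a function of the constant before [a]. Only for each approximation is
    it a continuous function of that constant, so the intermediate value theorem is applied at every
    index and the limit is taken afterwards. The operators may look at the whole past. An estimate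
    up to a time [y] therefore replaces the function by one that agrees with it up to [y] and
    satisfies the required inequality on the whole line; positivity or a growth condition is applied
    to that one, and causality leads back. To the left, [f] is truncated to [[0, kappa]], where its
    sign is known, but [l0] and [l1] to [[0, 2 * kappa]], which leaves room above the bound to be
    proved. Only the decrease of [u] is controlled there, so Gronwall's inequality runs backwards in
    time. To the right, the a priori bound must not depend on the truncation level, which is chosen
    after it. This works because a truncation symmetric about 0 keeps signs and does not increase
    the modulus. *)

Section epsilon_delta.
Context {R : realType}.
Implicit Types (u v : R -> R) (t e : R).

Lemma continuous_epsP u t : {for t, continuous u} <->
  forall e, 0 < e -> exists2 d : R, 0 < d &
    forall s, `|s - t| < d -> `|u s - u t| < e.
Proof.
split=> [/cvgrPdist_lt cu e e0|H].
  have /nbhs_ballP[d /= d0 H] := cu e e0.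
  by exists d => // s st; rewrite distrC; apply: H; rewrite /ball /= distrC.
apply/cvgrPdist_lt => e e0; have [d d0 Hd] := H e e0.
apply/nbhs_ballP; exists d => //= s; rewrite /ball /= => st.
by rewrite distrC; apply: Hd; rewrite distrC.
Qed.

End epsilon_delta.

Section interval_induction.
Context {R : realType}.

(** Compactness of [[a, b]] for properties of subintervals: the supremum of the points reached from
    [a] can be passed unless it is [b]. The local hypothesis concerns intervals that contain [t],
    not only those ending there. *)
Lemma itv_ind (P : R -> R -> Prop) (a b : R) : a <= b ->
  (forall x y z, a <= x -> x <= y -> y <= z -> z <= b ->
    P x y -> P y z -> P x z) ->
  (forall t, a <= t <= b -> exists2 d : R, 0 < d &
    forall x y, a <= x -> t - d < x -> x <= t -> t <= y -> y < t + d -> y <= b ->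
      P x y) ->
  P a b.
Proof.
move=> ab Ptrans Ploc.
pose S := [set y | a <= y <= b /\ P a y].
have Sa : S a.
  split; first by rewrite lexx ab.
  have [|d d0 H] := Ploc a; first by rewrite lexx ab.
  by apply: H => //; lra.
have Sub : ubound S b by move=> y [/andP[]].
have hsS : has_sup S by split; [exists a | exists b].
have sb : sup S <= b by apply: ge_sup => //; exists a.
have as_ : a <= sup S by apply: ub_le_sup => //; exists b.
have [|d d0 H] := Ploc (sup S); first by rewrite as_ sb.
have [y [/andP[ay yb] Pay] yd] := sup_adherent d0 hsS.
have ys : y <= sup S by apply: ub_le_sup; [exists b | split=> //; rewrite ay].
pose z := Num.min b (sup S + d / 2).
have sz : sup S <= z by rewrite /z le_min sb /=; lra.
have zb : z <= b by rewrite /z ge_min lexx.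
have zd : z < sup S + d by rewrite /z gt_min; apply/orP; right; lra.
have Pz : P a z.
  by apply: (Ptrans a y z) => //; [exact: le_trans sz | exact: H].
have Sz : S z by split=> //; rewrite zb (le_trans as_ sz).
have zs : z <= sup S by apply: ub_le_sup => //; exists b.
suff : z = b by move=> <-.
apply/eqP; rewrite eq_le zb /=.
by move: zs; rewrite /z ge_min => /orP[|] //; move=> h; rewrite le_min lexx /=; lra.
Qed.

End interval_induction.

(** * Integrals over compact intervals *)

Section integral_on_intervals.
Context {R : realType}.
Notation mu := (@lebesgue_measure R).
Notation Lloc := (@locally_integrable R [set: R]).
Implicit Types (h k : R -> R) (x y z : R).

Lemma aeS (P Q : R -> Prop) : (forall t, P t -> Q t) ->
  (\forall t \ae mu, P t) -> \forall t \ae mu, Q t.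
Proof.
exact: (@filterS _ (almost_everywhere mu) (ae_filter_ringOfSetsType mu) P Q).
Qed.

Lemma aeS2 (P Q S : R -> Prop) : (forall t, P t -> Q t -> S t) ->
  (\forall t \ae mu, P t) -> (\forall t \ae mu, Q t) -> \forall t \ae mu, S t.
Proof.
exact: (@filterS2 _ (almost_everywhere mu) (ae_filter_ringOfSetsType mu) P Q S).
Qed.

Lemma aeS3 (P Q S T : R -> Prop) : (forall t, P t -> Q t -> S t -> T t) ->
  (\forall t \ae mu, P t) -> (\forall t \ae mu, Q t) ->
  (\forall t \ae mu, S t) -> \forall t \ae mu, T t.
Proof.
exact: (@filterS3 _ (almost_everywhere mu) (ae_filter_ringOfSetsType mu) P Q S T).
Qed.

Lemma aeT (P : R -> Prop) : (forall t, P t) -> \forall t \ae mu, P t.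
Proof.
exact: (@filterE _ (almost_everywhere mu) (ae_filter_ringOfSetsType mu) P).
Qed.

Lemma ae_neq (c : R) : \forall t \ae mu, t != c.
Proof.
exists [set c]; split => //; first exact: lebesgue_measure_set1.
by move=> t /= /negP; rewrite negbK => /eqP.
Qed.

(** For [y < x] the interval is empty and the value is 0, not the opposite of the integral from [y]
    to [x]; hence the order hypotheses in additivity and the [Num.max] in primitives. *)
Definition inta h x y : R := \int[mu]_(s in `[x, y]) h s.

Lemma Lloc_integrable h x y : Lloc h -> mu.-integrable `[x, y] (EFin \o h).
Proof.
move=> [mh _ hK]; apply/integrableP; split.
  by apply/measurable_EFinP; exact: measurable_funTS.
by apply: hK => //; exact: segment_compact.
Qed.

Lemma Lloc_le h k : measurable_fun setT h -> Lloc k ->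
  (forall t, `|h t| <= `|k t|) -> Lloc h.
Proof.
move=> mh [mk oT kK] hk; split => // K KT cK.
apply: le_lt_trans (kK _ KT cK); apply: ge0_le_integral => //=.
- exact: compact_measurable.
- by apply/measurable_EFinP/measurableT_comp => //; exact: measurable_funTS.
- by apply/measurable_EFinP/measurableT_comp => //; exact: measurable_funTS.
- by move=> t _; rewrite lee_fin.
Qed.

Lemma Lloc_norm h : Lloc h -> Lloc (fun t => `|h t|).
Proof.
move=> lh; apply: (Lloc_le _ lh); last by move=> t; rewrite normr_id.
by case: lh => mh _ _; exact: measurableT_comp.
Qed.

Lemma LlocD h k : Lloc h -> Lloc k -> Lloc (fun t => h t + k t).
Proof. exact: locally_integrableD. Qed.

Lemma LlocB h k : Lloc h -> Lloc k -> Lloc (fun t => h t - k t).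
Proof. exact: locally_integrableB. Qed.

Lemma continuous_Lloc h : continuous h -> Lloc h.
Proof.
move=> ch; split; [|exact: openT|].
  by apply: continuous_measurable_fun => //; exact: measurableT.
move=> K _ cK.
by have /integrableP[] :=
  @continuous_compact_integrable R h K cK (continuous_subspaceT ch).
Qed.

Lemma LlocM h (c : R -> R) : Lloc h -> continuous c -> Lloc (fun t => h t * c t).
Proof.
move=> lh cc; have [mh oT hK] := lh.
have mc : measurable_fun setT c.
  by apply: continuous_measurable_fun => //; exact: measurableT.
split => //; first exact: measurable_funM.
move=> K KT cK.
have mK : measurable K by exact: compact_measurable.
have [M [Mr HM]] : \forall M \near +oo, forall x, K x -> `|c x| <= M.
  have /compact_bounded : compact (c @` K).
    by apply: continuous_compact => //; exact: continuous_subspaceT.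
  move=> [M [Mr HM]]; exists M; split=> // x Mx y Ky.
  by apply: (HM x Mx); exists y.
pose N := `|M| + 1.
have cN x : K x -> `|c x| <= N.
  by apply: HM; rewrite /N; have := ler_norm M; lra.
have N0 : 0 <= N by rewrite /N addr_ge0.
have : (\int[mu]_(x in K) (N%:E * `|h x|%:E) < +oo)%E.
  rewrite ge0_integralZl//=; first by rewrite lte_mul_pinfty// hK.
  by apply/measurable_EFinP/measurableT_comp => //; exact: measurable_funTS.
apply: le_lt_trans; apply: ge0_le_integral => //=.
- apply/measurable_EFinP/measurableT_comp => //; apply: measurable_funTS.
  exact: measurable_funM.
- apply: emeasurable_funM => //.
  by apply/measurable_EFinP/measurableT_comp => //; exact: measurable_funTS.
- by move=> t Kt; rewrite -EFinM lee_fin normrM mulrC ler_wpM2r// cN.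
Qed.

Lemma LlocZ h (r : R) : Lloc h -> Lloc (fun t => r * h t).
Proof.
move=> lh; under eq_fun do rewrite mulrC.
by apply: LlocM => //; exact: cst_continuous.
Qed.

Lemma inta_chasles h x y z : Lloc h -> x <= y -> y <= z ->
  inta h x z = inta h x y + inta h y z.
Proof.
move=> lh xy yz; rewrite /inta.
have := @Rintegral_itvB R h (BLeft x) (BRight z) y (Lloc_integrable x z lh).
rewrite !bnd_simp => /(_ xy yz) H.
rewrite -[\int[mu]_(s in `[y, z]) _]Rintegral_itv_obnd_cbnd -?H; first by ring.
apply: integrableS (Lloc_integrable y z lh) => //.
by apply: subset_itvr; rewrite bnd_simp.
Qed.

Lemma inta_xx h x : inta h x x = 0.
Proof. by rewrite /inta set_itv1 Rintegral_set1. Qed.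

Lemma intaD h k x y : Lloc h -> Lloc k ->
  inta (fun t => h t + k t) x y = inta h x y + inta k x y.
Proof. by move=> lh lk; rewrite /inta RintegralD//; exact: Lloc_integrable. Qed.

Lemma intaB h k x y : Lloc h -> Lloc k ->
  inta (fun t => h t - k t) x y = inta h x y - inta k x y.
Proof. by move=> lh lk; rewrite /inta RintegralB//; exact: Lloc_integrable. Qed.

Lemma intaZ h r x y : Lloc h -> inta (fun t => r * h t) x y = r * inta h x y.
Proof. by move=> lh; rewrite /inta RintegralZl//; exact: Lloc_integrable. Qed.

Lemma eq_inta h k x y : (forall t, x <= t -> t <= y -> h t = k t) ->
  inta h x y = inta k x y.
Proof.
by move=> hk; apply: eq_Rintegral => t; rewrite inE/= in_itv/= => /andP[? ?]; exact: hk.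
Qed.

Lemma inta_cst r x y : x <= y -> inta (fun=> r) x y = r * (y - x).
Proof.
move=> xy; rewrite /inta Rintegral_cst//= lebesgue_measure_itv/= lte_fin.
move: xy; rewrite le_eqVlt => /predU1P[->|->//].
by rewrite ltxx subrr.
Qed.

Lemma inta_ge0_ae h x y : Lloc h ->
  (\forall t \ae mu, x <= t -> t <= y -> 0 <= h t) -> 0 <= inta h x y.
Proof.
move=> lh h0.
rewrite /inta /Rintegral (@ae_eq_integral _ _ _ mu `[x, y]%classic
  (fun t => (Num.max (h t) 0)%:E)) //.
- by apply: fine_ge0; apply: integral_ge0 => t _; rewrite lee_fin le_max lexx orbT.
- by apply/measurable_EFinP; case: lh => mh _ _; exact: measurable_funTS.
- apply/measurable_EFinP; case: lh => mh _ _; apply: measurable_funTS.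
  by apply: measurable_maxr => //.
- move: h0; apply: aeS => t h0; rewrite /= in_itv/= => /andP[xt ty].
  by rewrite max_l// h0.
Qed.

Lemma le_inta_ae h k x y : Lloc h -> Lloc k ->
  (\forall t \ae mu, x <= t -> t <= y -> h t <= k t) ->
  inta h x y <= inta k x y.
Proof.
move=> lh lk hk; rewrite -subr_ge0 -intaB//.
apply: inta_ge0_ae; first exact: LlocB.
by move: hk; apply: aeS => t hk xt ty; rewrite subr_ge0 hk.
Qed.

Lemma eq_inta_ae h k x y : Lloc h -> Lloc k ->
  (\forall t \ae mu, x <= t -> t <= y -> h t = k t) ->
  inta h x y = inta k x y.
Proof.
move=> lh lk hk; apply/eqP; rewrite eq_le; apply/andP; split;
  by apply: le_inta_ae => //; move: hk; apply: aeS => t hk xt ty; rewrite hk.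
Qed.

Lemma inta_norm h x y : Lloc h -> `|inta h x y| <= inta (fun t => `|h t|) x y.
Proof. by move=> lh; apply: le_normr_Rintegral => //; exact: Lloc_integrable. Qed.

Lemma inta_le_norm h k x y : Lloc h -> Lloc k ->
  (\forall t \ae mu, x <= t -> t <= y -> `|h t| <= k t) ->
  `|inta h x y| <= inta k x y.
Proof.
move=> lh lk hk; apply: le_trans (inta_norm _ _ lh) _.
by apply: le_inta_ae => //; exact: Lloc_norm.
Qed.

Lemma inta_ge0 h x y : (forall t, 0 <= h t) -> 0 <= inta h x y.
Proof. by move=> h0; apply: Rintegral_ge0. Qed.

Lemma inta_subitv h a b x y : Lloc h -> a <= x -> x <= y -> y <= b ->
  (\forall t \ae mu, a <= t -> t <= b -> 0 <= h t) -> inta h x y <= inta h a b.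
Proof.
move=> lh ax xy yb h0.
rewrite (inta_chasles lh ax (le_trans xy yb)) (inta_chasles lh xy yb).
have H1 : 0 <= inta h a x.
  apply: inta_ge0_ae => //; move: h0; apply: aeS => t h0 at_ tx; apply: h0 => //.
  exact: le_trans tx (le_trans xy yb).
have H2 : 0 <= inta h y b.
  apply: inta_ge0_ae => //; move: h0; apply: aeS => t h0 at_ tx; apply: h0 => //.
  exact: le_trans (le_trans ax xy) at_.
by lra.
Qed.

Lemma Rintegral_norm_ac h (a b e : R) : Lloc h -> 0 < e -> exists2 d : R, 0 < d &
  forall A : set R, measurable A -> A `<=` `[a, b] -> (mu A < d%:E)%E ->
    \int[mu]_(s in A) `|h s| < e.
Proof.
move=> lh e0; pose hab := h \_ `[a, b].
have ih : mu.-integrable setT (EFin \o hab).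
  rewrite /hab -restrict_EFin; apply/(integrable_mkcond _ _).1 => //.
  exact: Lloc_integrable.
have [d [d0 H]] := integral_normr_continuous ih e0.
exists d => // A mA Aab /H => /(_ mA); apply: le_lt_trans.
rewrite le_eqVlt; apply/orP; left; apply/eqP/eq_Rintegral => s sA.
by rewrite /hab patchE mem_set//; apply: Aab; exact/set_mem.
Qed.

Lemma inta_small h (t e : R) : Lloc h -> 0 < e -> exists2 d : R, 0 < d &
  forall x y, t - d < x -> y < t + d -> inta (fun s => `|h s|) x y < e.
Proof.
move=> lh e0; have [d d0 H] := Rintegral_norm_ac (t - 1) (t + 1) lh e0.
(* An interval inside the window is shorter than twice its radius, hence [d / 2]; the radius 1 keeps
   it in [[t - 1, t + 1]]. *)
exists (Num.min 1 (d / 2)); first by rewrite lt_min; apply/andP; split; lra.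
move=> x y; rewrite ltrBlDr -ltrBlDl lt_min => /andP[x1 x2].
rewrite -ltrBlDl lt_min => /andP[y1 y2].
apply: H => //.
  move=> s /=; rewrite !in_itv/= => /andP[xs sy].
  by apply/andP; split; lra.
rewrite lebesgue_measure_itv/= lte_fin; case: ifPn => _; last by rewrite lte_fin.
by rewrite -EFinB lte_fin; lra.
Qed.

Lemma continuous_prim h a : Lloc h ->
  continuous (fun t => inta h a (Num.max t a)).
Proof.
move=> lh t; apply/continuous_epsP => e e0.
have [d d0 H] := inta_small t lh e0.
have key x y : x <= y ->
    `|inta h a (Num.max y a) - inta h a (Num.max x a)| <= inta (fun s => `|h s|) x y.
  move=> xy.
  have [ya|ay] := leP y a; have [xa|ax] := leP x a; rewrite ?inta_xx ?subrr ?normr0.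
  - by apply: inta_ge0.
  - by move: (lt_le_trans ax (le_trans xy ya)); rewrite ltxx.
  - rewrite subr0; apply: le_trans (inta_norm _ _ lh) _.
    apply: inta_subitv => //; [exact: Lloc_norm | exact: ltW |].
    by apply: aeT.
  - rewrite (inta_chasles lh (ltW ax) xy) addrC addKr.
    exact: inta_norm.
exists d => // s; rewrite ltr_norml => /andP[sd1 sd2].
have [ts|st] := leP t s.
  by apply: le_lt_trans (key _ _ ts) _; apply: H; lra.
by rewrite distrC; apply: le_lt_trans (key _ _ (ltW st)) _; apply: H; lra.
Qed.

End integral_on_intervals.

(** * Absolute continuity and Gronwall inequalities *)

Section absolute_continuity.
Context {R : realType}.
Notation mu := (@lebesgue_measure R).
Notation Lloc := (@locally_integrable R [set: R]).
Implicit Types (h u v : R -> R) (a b : R).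

(** The integral of [|h|] over the union [D] of the given disjoint intervals dominates the sum of
    the increments, and it is small because [D] has small measure. *)
Lemma AC_primitive h u a b : Lloc h ->
  (forall x y, a <= x -> x <= y -> y <= b -> u y - u x = inta h x y) ->
  absolutely_continuous_on a b u.
Proof.
move=> lh uh e e0; have [d d0 H] := Rintegral_norm_ac a b lh e0.
exists d => // n x y xy tri sumd.
pose F (i : 'I_n) := `]x i, y i[%classic : set R.
have mF i : measurable (F i) by exact: measurable_itv.
pose D := \big[setU/set0]_(i < n) F i.
have mD : measurable D by apply: bigsetU_measurable.
have Dab : D `<=` `[a, b].
  rewrite /D -bigcup_seq => s [i _]; rewrite /F /= !in_itv/= => /andP[xs sy].
  have [ax _ yb] := xy i.
  by rewrite (le_trans ax (ltW xs)) (le_trans (ltW sy) yb).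
have muD : (mu D < d%:E)%E.
  rewrite /D measure_bigsetU_ord//; apply: le_lt_trans (_ : (\sum_(i < n) (y i - x i))%:E < _)%E.
    rewrite -sumEFin le_eqVlt; apply/orP; left; apply/eqP; apply: eq_bigr => i _.
    by rewrite /F /= lebesgue_measure_itv/= lte_fin; have [_ -> _] := xy i.
  by rewrite lte_fin.
apply: le_lt_trans (H D mD Dab muD).
have lnh := Lloc_norm lh; have mnh : measurable_fun setT (fun t => `|h t|) by case: lnh.
have -> : \int[mu]_(s in D) `|h s| = \sum_(i < n) inta (fun s => `|h s|) (x i) (y i).
  apply: EFin_inj; rewrite /Rintegral fineK; last first.
    apply: integrable_fin_num => //; apply: integrableS (Lloc_integrable a b lnh) => //.
  rewrite /D ge0_integral_bigsetU//.
  - rewrite -sumEFin; apply: eq_bigr => i _; rewrite /inta.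
    rewrite -Rintegral_itv_obnd_cbnd; last first.
      apply: integrableS (Lloc_integrable (x i) (y i) lnh) => //.
      by apply: subset_itvr; rewrite bnd_simp.
    rewrite -Rintegral_itv_bndo_bndc; last first.
      apply: integrableS (Lloc_integrable (x i) (y i) lnh) => //.
      exact: subset_itv_oo_cc.
    rewrite /Rintegral fineK//; apply: integrable_fin_num => //.
    apply: integrableS (Lloc_integrable (x i) (y i) lnh) => //.
    exact: subset_itv_oo_cc.
  - exact: index_enum_uniq.
  - by move: tri; apply: sub_trivIset.
  - by apply/measurable_EFinP; exact: measurable_funTS.
apply: ler_sum => i _; have [ax xyi yb] := xy i.
rewrite uh//; last exact: ltW.
exact: inta_norm.
Qed.

Lemma ACB u v a b : absolutely_continuous_on a b u ->
  absolutely_continuous_on a b v ->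
  absolutely_continuous_on a b (fun t => u t - v t).
Proof.
move=> ACu ACv e e0; have e20 : 0 < e / 2 by lra.
have [d1 d10 H1] := ACu _ e20; have [d2 d20 H2] := ACv _ e20.
exists (Num.min d1 d2); first by rewrite lt_min d10.
move=> n x y xy tri; rewrite lt_min => /andP[s1 s2].
have := ltrD (H1 n x y xy tri s1) (H2 n x y xy tri s2).
rewrite -splitr -big_split/=; apply: le_lt_trans; apply: ler_sum => i _.
rewrite (_ : _ - _ - _ = (u (y i) - u (x i)) - (v (y i) - v (x i))); last by ring.
exact: ler_normB.
Qed.

(** Straddle estimate: the difference quotient is bounded on both sides of [t] and the two bounds
    are added, so [t] need not be an endpoint. *)
Lemma derive1_le0_local u (t e : R) : 0 < e -> derivable u t 1 -> derive1 u t <= 0 ->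
  exists2 d : R, 0 < d & forall x y,
    t - d < x -> x <= t -> t <= y -> y < t + d -> u y - u x <= e * (y - x).
Proof.
move=> e0 du u'0.
have : s^-1 *: (u (s + t) - u t) @[s --> (0 : R)^'] --> derive1 u t.
  suff : cvg (s^-1 *: (u (s + t) - u t) @[s --> (0 : R)^']) by [].
  move: du; rewrite /derivable.
  rewrite (_ : (fun s => s^-1 *: ((u \o shift t) (s *: 1) - u t)) =
               (fun s : R => s^-1 *: (u (s + t) - u t)))//.
  by apply/funext => s /=; rewrite /shift /= [_ *: 1]mulr1.
move=> /cvgrPdist_lt/(_ e e0) /nbhs_ballP[d /= d0 H].
exists d => // x y dx xt ty yd.
have Hs s : s != 0 -> `|s| < d -> s^-1 * (u (s + t) - u t) < e.
  move=> s0 sd; have /= := H s; rewrite /ball/= sub0r normrN => /(_ sd s0).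
  by rewrite ltr_norml => /andP[+ _]; rewrite /GRing.scale/=; lra.
have Hy : u y - u t <= e * (y - t).
  move: ty; rewrite le_eqVlt => /predU1P[->|ty]; first by rewrite !subrr mulr0.
  have yt0 : 0 < y - t by rewrite subr_gt0.
  have := Hs (y - t); rewrite subrK gt_eqF// gtr0_norm// => /(_ isT).
  by rewrite ltrBlDl => /(_ yd) /ltW; rewrite mulrC ler_pdivrMr.
have Hx : u t - u x <= e * (t - x).
  move: xt; rewrite le_eqVlt => /predU1P[->|xt]; first by rewrite !subrr mulr0.
  have xt0 : x - t < 0 by rewrite subr_lt0.
  have tx0 : 0 < t - x by rewrite subr_gt0.
  have := Hs (x - t); rewrite subrK lt_eqF// ltr0_norm// opprB => /(_ isT).
  have -> : (x - t)^-1 * (u x - u t) = (u t - u x) / (t - x).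
    by rewrite -(opprB t x) invrN mulNr -mulrN opprB mulrC.
  by rewrite ltr_pdivrMr// => H'; apply/ltW/H'; lra.
by have := lerD Hx Hy; rewrite -mulrDr; rewrite (_ : t - x + (y - t) = y - x); lra.
Qed.

(* Cousin-type argument: points of a null set are covered by intervals inside
   a small open set [U], on which absolute continuity controls the increments. *)
Lemma AC_derive1_le0 u a b : a <= b -> absolutely_continuous_on a b u ->
  (\forall t \ae mu, a < t -> t < b -> derivable u (t : R) 1 /\ derive1 u t <= 0) ->
  u b <= u a.
Proof.
move=> ab ACu u'.
suff Hmain (e : R) : 0 < e -> u b - u a <= e * (b - a) + e.
  rewrite leNgt; apply/negP => uab.
  have c0 : 0 < b - a + 1 by lra.
  (* This value makes [e * (b - a) + e] half of the supposed increment. *)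
  have e0 : 0 < (u b - u a) / (2 * (b - a + 1)).
    by rewrite divr_gt0 ?mulr_gt0 ?subr_gt0.
  have := Hmain _ e0.
  rewrite [X in _ <= X](_ : _ = (u b - u a) / 2); first lra.
  by field; rewrite gt_eqF.
move=> e0.
have [d d0 Hd] := ACu e e0.
have [A [mA A0 HA]] := u'.
(* The endpoints join the null set because the derivative is controlled only inside the interval. *)
pose N : set R := A `|` [set a; b].
have mN : measurable N by do 2 (apply: measurableU => //).
have N0 : mu N = 0%E.
  rewrite /N measureU0//; first exact: measurableU.
  rewrite measureU0//; exact: lebesgue_measure_set1.
have Nfin : (mu N < +oo)%E by rewrite N0.
have [U [oU NU muU]] := lebesgue_regularity_outer mN Nfin d0.
have mU : measurable U by exact: open_measurable.
have {}muU : (mu U < d%:E)%E.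
  suff -> : U = (U `\` N) `|` N by rewrite measureU0//; exact: measurableD.
  by rewrite setUC setDUK.
have lU : Lloc \1_U by apply: locally_integrable_indic => //; exact: openT.
(* [s] collects the pieces used at points of [N]. Bounding their total length by the measure of [U]
   inside [[x, y]], rather than by [d], gives a property that adds up under concatenation. *)
pose P x y := exists s : seq (R * R),
  [/\ all (fun p => [&& x <= p.1, p.1 < p.2 & p.2 <= y]) s,
      pairwise (fun p q => p.2 <= q.1) s,
      \sum_(p <- s) (p.2 - p.1) <= inta \1_U x y &
      u y - u x <= e * (y - x) + \sum_(p <- s) `|u p.2 - u p.1|].
have [s [/allP /= sall spw ssum su]] : P a b.
  apply: itv_ind => //.
  - move=> x y z ax xy yz zb [s [sall spw ssum su]] [s' [sall' spw' ssum' su']].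
    exists (s ++ s'); split.
    + rewrite all_cat; apply/andP; split.
      * apply: sub_all sall => p /and3P[-> -> /= h].
        exact: le_trans yz.
      * by apply: sub_all sall' => p /and3P[h -> ->]; rewrite (le_trans xy h).
    + rewrite pairwise_cat spw spw' !andbT.
      apply/allrelP => p q ps qs.
      have /and3P[_ _ py] := allP sall _ ps.
      have /and3P[yq _ _] := allP sall' _ qs.
      exact: le_trans yq.
    + by rewrite big_cat /= (inta_chasles lU xy yz) lerD.
    + rewrite big_cat /=; have := lerD su su'.
      by rewrite (_ : e * (z - x) = e * (y - x) + e * (z - y)); [lra | ring].
  - move=> t tab; have [tN|tN] := pselect (N t).
      have /(_ t (NU _ tN)) := oU; rewrite /interior => /nbhs_ballP[r /= r0 rU].
      exists r => // x y ax tx xt ty yt yb.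
      have xy := le_trans xt ty.
      move: (xy); rewrite le_eqVlt => /predU1P[<-|xy'].
        exists [::]; split=> //; rewrite !big_nil ?inta_xx//.
        by rewrite !subrr mulr0 addr0.
      exists [:: (x, y)]; rewrite /= !big_seq1 /= !lexx xy'; split=> //.
        rewrite (@eq_inta _ _ (fun=> 1)) ?inta_cst ?mul1r//.
        move=> s xs sy; rewrite indicE mem_set//; apply: rU.
        by rewrite /ball /= ltr_norml; apply/andP; split; lra.
      have := ler_norm (u y - u x); have : 0 <= e * (y - x).
        by apply: mulr_ge0; lra.
      lra.
    have tA : ~ A t by move=> ?; apply: tN; left.
    have at_ : a < t.
      rewrite lt_neqAle; move: tab => /andP[-> _]; rewrite andbT.
      by apply/eqP => h; apply: tN; right; left.
    have tb : t < b.
      rewrite lt_neqAle; move: tab => /andP[_ ->]; rewrite andbT.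
      by apply/eqP => h; apply: tN; right; right.
    have [du u'0] : derivable u t 1 /\ derive1 u t <= 0.
      by apply: contrapT => h; apply: tA; apply: HA => h'; apply: h; exact: h'.
    have [r r0 Hr] := derive1_le0_local e0 du u'0.
    exists r => // x y ax tx xt ty yt yb; exists [::]; split=> //.
      by rewrite big_nil; apply: inta_ge0 => s; rewrite indicE.
    by rewrite big_nil addr0 Hr.
have sd : \sum_(p <- s) (p.2 - p.1) < d.
  apply: le_lt_trans ssum _.
  rewrite -lte_fin /inta /Rintegral fineK; last first.
    exact: integrable_fin_num (Lloc_integrable a b lU).
  rewrite integral_indic//; apply: le_lt_trans muU.
  apply: le_measure; rewrite ?inE//.
  exact: measurableI.
pose x (i : 'I_(size s)) := (nth (0, 0) s i).1.
pose y (i : 'I_(size s)) := (nth (0, 0) s i).2.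
have := Hd (size s) x y.
rewrite (big_nth (0, 0)) big_mkord in sd.
move=> /(_ _ _ sd) H.
have {}H : \sum_(i < size s) `|u (y i) - u (x i)| < e.
  apply: H => [i|i j _ _ [r [/=]]].
    by have /and3P[? ? ?] := sall _ (mem_nth (0, 0) (ltn_ord i)).
  rewrite !in_itv /= => /andP[xi iy] /andP[xj jy]; apply/val_inj => /=.
  have /(pairwiseP (0, 0)) pw := spw.
  case: (ltngtP i j) => // ij.
    have := pw i j (ltn_ord i) (ltn_ord j) ij; rewrite -/(x j) -/(y i) => h.
    by have := lt_trans xj (lt_le_trans iy h); rewrite ltxx.
  have := pw j i (ltn_ord j) (ltn_ord i) ij; rewrite -/(x i) -/(y j) => h.
  by have := lt_trans xi (lt_le_trans jy h); rewrite ltxx.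
apply: le_trans su _; rewrite lerD2l (big_nth (0, 0)) big_mkord.
exact: ltW.
Qed.

End absolute_continuity.

Section gronwall.
Context {R : realType}.
Implicit Types (z P m : R -> R) (s t : R).

(* The local hypothesis says [- dz <= z dP] without differentiability of [z]. *)
Lemma gronwall_backward z P s t : s <= t -> continuous z ->
  (forall x, s <= x -> x <= t -> 0 <= z x) ->
  (forall x y, s <= x -> x <= y -> y <= t -> P x <= P y) ->
  (forall r e : R, s <= r -> r <= t -> 0 < e -> exists2 d : R, 0 < d &
    forall x y, s <= x -> r - d < x -> x <= r -> r <= y -> y < r + d -> y <= t ->
      z x - z y <= (P y - P x) * (z r + e)) ->
  z s <= z t * expR (P t - P s).
Proof.
move=> st cz z0 Pmono zloc.
(* Near [r] one has [z r + d / 2 <= (1 + d) * (z y + d)], so the error allowed in the local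
   hypothesis is absorbed by the factor [1 + d] in the exponent. Letting [d] tend to 0 removes
   it. *)
have perturbed (d : R) : 0 < d ->
    z s + d <= (z t + d) * expR ((1 + d) * (P t - P s)).
  move=> d0.
  pose C x y := z x + d <= (z y + d) * expR ((1 + d) * (P y - P x)).
  apply: (@itv_ind _ C) => // [x y w sx xy yw wt Cxy Cyw|r /andP[sr rt]].
    apply: le_trans Cxy _.
    rewrite (_ : (1 + d) * (P w - P x) =
      (1 + d) * (P w - P y) + (1 + d) * (P y - P x)); last by ring.
    by rewrite expRD mulrA ler_wpM2r ?expR_ge0.
  have d20 : 0 < d / 2 by lra.
  have [d1 d10 H1] := zloc r (d / 2) sr rt d20.
  have [d2 d20' H2] := (continuous_epsP z r).1 (cz r) (d / 2) d20.
  exists (Num.min d1 d2); first by rewrite lt_min d10.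
  move=> x y sx; rewrite ltrBlDr -ltrBlDl lt_min => /andP[x1 x2] xr ry.
  rewrite -ltrBlDl lt_min => /andP[y1 y2] yt.
  have xy := le_trans xr ry.
  have Pxy : 0 <= P y - P x by rewrite subr_ge0 Pmono.
  have zxy : z x - z y <= (P y - P x) * (z r + d / 2) by apply: H1 => //; lra.
  have zr0 := z0 r sr rt.
  have zy0 := z0 y (le_trans sr ry) yt.
  have zyr : z r + d / 2 <= (1 + d) * (z y + d).
    have : `|z y - z r| < d / 2 by apply: H2; rewrite ltr_norml; apply/andP; split; lra.
    rewrite ltr_norml => /andP[h _].
    have := mulr_ge0 (ltW d0) (addr_ge0 zy0 (ltW d0)); lra.
  rewrite /C.
  have : (z y + d) * (1 + (1 + d) * (P y - P x)) <=
         (z y + d) * expR ((1 + d) * (P y - P x)).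
    by rewrite ler_wpM2l ?expR_ge1Dx// addr_ge0// ltW.
  apply: le_trans.
  have h := ler_wpM2l Pxy zyr.
  have -> : (z y + d) * (1 + (1 + d) * (P y - P x)) =
            z y + d + (P y - P x) * ((1 + d) * (z y + d)) by ring.
  lra.
pose h (r : R) := (z t + r) * expR ((1 + r) * (P t - P s)) - (z s + r).
have ch : {for 0, continuous h}.
  apply: cvgB; last by apply: cvgD; [exact: cvg_cst | exact: cvg_id].
  apply: cvgM; first by apply: cvgD; [exact: cvg_cst | exact: cvg_id].
  apply: continuous_cvg; first exact: continuous_expR.
  apply: cvgM; last exact: cvg_cst.
  by apply: cvgD; [exact: cvg_cst | exact: cvg_id].
have h0 : h 0 = z t * expR (P t - P s) - z s by rewrite /h !addr0 mul1r.
rewrite -subr_ge0 -h0 leNgt; apply/negP => hneg.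
have [|d d0 H] := (continuous_epsP h 0).1 ch (- h 0); first by lra.
have /H : `|d / 2 - 0| < d by rewrite subr0 ger0_norm; lra.
have : 0 <= h (d / 2) by rewrite subr_ge0; apply: perturbed; lra.
rewrite ltr_norml => ? /andP[_ ?]; lra.
Qed.

(* [K] depends on [P] only, so the resulting a priori bounds hold for all
   solutions at once. *)
Lemma gronwall_coarse P s t : s <= t -> continuous P ->
  exists2 K : R, 0 <= K & forall m (Q : R), 0 <= Q -> (forall x, 0 <= m x) ->
    (forall x y, s <= x -> x <= y -> y <= t -> m y <= m x + (P y - P x) * m y + Q) ->
    m t <= K * (m s + Q).
Proof.
move=> st cP.
pose C x y := exists2 K : R, 0 <= K & forall m (Q : R), 0 <= Q -> (forall x, 0 <= m x) ->
  (forall x y, s <= x -> x <= y -> y <= t -> m y <= m x + (P y - P x) * m y + Q) ->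
  m y <= K * (m x + Q).
apply: (@itv_ind _ C) => // [x y w sx xy yw wt [K K0 HK] [L L0 HL]|r /andP[sr rt]].
  exists (L * (K + 1)) => [|m Q Q0 m0 mH].
    by apply: mulr_ge0 => //; apply: addr_ge0.
  apply: le_trans (HL m Q Q0 m0 mH) _.
  rewrite -mulrA ler_wpM2l// mulrDl mul1r.
  by have := HK m Q Q0 m0 mH; have := m0 x; lra.
have h0 : 0 < 4^-1 :> R by [].
have [d d0 H] := (continuous_epsP P r).1 (cP r) _ h0.
exists d => // x y sx dx xr ry yd yt.
(* [P] varies by less than 1/2 on this piece, so half of [m y] is absorbed in the left-hand side. *)
exists 2 => // m Q Q0 m0 mH.
have := mH x y sx (le_trans xr ry) yt.
have Px : `|P x - P r| < 4^-1 by apply: H; rewrite ltr_norml; apply/andP; split; lra.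
have Py : `|P y - P r| < 4^-1 by apply: H; rewrite ltr_norml; apply/andP; split; lra.
have : (P y - P x) * m y <= 2^-1 * m y.
  apply: ler_wpM2r => //.
  by move: Px Py; rewrite !ltr_norml => /andP[? ?] /andP[? ?]; lra.
lra.
Qed.

End gronwall.

(** * Causal operators and limits along an ultrafilter *)

Section causal_operators.
Context {R : realType}.
Notation mu := (@lebesgue_measure R).
Notation Lloc := (@locally_integrable R [set: R]).
Implicit Types (F T : (R -> R) -> R -> R) (u v w : R -> R).

(* Continuity from C_loc to L_loc in epsilon-delta form. *)
Definition int_continuous F := forall u, continuous u -> forall a b e : R, 0 < e ->
  exists2 d : R, 0 < d & exists m : R, forall w, continuous w ->
    (forall t, - m <= t -> t <= m -> `|w t - u t| < d) ->
    inta (fun s => `|F w s - F u s|) a b < e.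

(** Compact sets are bounded, so uniform closeness on the intervals [[-m, m]] generates a filter
    finer than the neighbourhoods of [u] for compact convergence. *)
Lemma continuous_operator_int T : continuous_operator T -> int_continuous T.
Proof.
move=> [_ cT] u cu a b e e0.
pose B (p : R * R) : set (R -> R) :=
  [set w | forall t, - p.1 <= t -> t <= p.1 -> `|w t - u t| < p.2].
pose G := filter_from [set p : R * R | 0 < p.2] B.
have FG : Filter G.
  apply: filter_from_filter; first by exists (0, 1) => /=.
  move=> [m1 d1] [m2 d2] /= d10 d20.
  exists (Num.max m1 m2, Num.min d1 d2); first by rewrite /= lt_min d10.
  move=> w Bw; split=> t /= t1 t2; have := Bw t; rewrite /= lt_min.
    move=> /(_ _ _)/andP[]// ; last by rewrite le_max t2.
    by apply: le_trans t1; rewrite lerN2 le_max lexx.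
  move=> /(_ _ _)/andP[]// ; last by rewrite le_max t2 orbT.
  by apply: le_trans t1; rewrite lerN2 le_max lexx orbT.
have Gu : G `=>` nbhs (u : {family compact, R -> R}).
  apply/fam_cvgP => A cA P /uniform_nbhs[E [entE EP]].
  have [d /= d0 dE] : filter_from [set x : R | 0 < x]
      (fun e : R => [set xy : R * R | ball xy.1 e xy.2]) E.
    by rewrite entourage_from_ballE.
  have [M [Mr HM]] := compact_bounded cA.
  exists (`|M| + 1, d) => //= w Bw; apply: EP => y Ay.
  have : `|y| <= `|M| + 1 by apply: HM => //; have := ler_norm M; lra.
  rewrite ler_norml => /andP[y1 y2].
  by apply: dE; rewrite /ball /= distrC; exact: Bw.
have /fine_cvg/cvgrPdist_lt/(_ e e0) := cT u cu a b.
move=> /(Gu _)[[m d] /= d0 H].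
exists d => //; exists m => w cw wu.
have := H w wu cw; rewrite /= sub0r normrN; apply: le_lt_trans.
exact: ler_norm.
Qed.

(** What the approximation scheme requires of a right-hand side. The bound [G] has to serve all
    continuous arguments at once; the truncations below are made to provide it. *)
Record causal_operator F : Prop := CausalOperator {
  causal_Lloc : forall u, continuous u -> Lloc (F u);
  causal_continuous : int_continuous F;
  causal_eq : forall z u v, continuous u -> continuous v ->
    (forall s, s <= z -> u s = v s) -> \forall t \ae mu, t <= z -> F u t = F v t;
  causal_bound : forall b, exists2 G, Lloc_nonneg G &
    forall v, continuous v -> \forall t \ae mu, t <= b -> `|F v t| <= G t }.

Lemma causal_inta_eq F u v x y : causal_operator F -> continuous u -> continuous v ->
  (forall s, s <= y -> u s = v s) -> inta (F u) x y = inta (F v) x y.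
Proof.
move=> FC cu cv uv; apply: eq_inta_ae; [exact: causal_Lloc|exact: causal_Lloc|].
by apply: aeS (causal_eq FC cu cv uv) => t H _ /H.
Qed.

End causal_operators.

Section ultrafilter_limits.
Context {R : realType} (U : set_system nat) {UU : UltraFilter U}.
Implicit Types (un vn : nat -> R -> R) (u v : R -> R).

Let PU : ProperFilter U := ultra_proper.
Existing Instance PU.

Lemma ultra_bounded_cvg (x : nat -> R) (M : R) : (forall n, `|x n| <= M) ->
  exists l : R, x n @[n --> U] --> l.
Proof.
move=> xM; have cK := @segment_compact R (- M) M.
have [|l [_ ll]] := cK (x n @[n --> U]) (fmap_proper_filter x PU).
  by apply: (@filterE _ U) => n /=; rewrite in_itv/= -ler_norml.
exists l => A nA.
have [//|UnA] := in_ultra_setVsetC (x @^-1` A) UU.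
have [y [/= ny Ay]] := ll (~` A) A UnA nA.
by [].
Qed.

Definition locally_uniform un u := forall t e : R, 0 < e ->
  exists2 d : R, 0 < d & \forall n \near U, forall s, `|s - t| < d -> `|un n s - u s| < e.

Lemma locally_uniform_cvg un u t : locally_uniform un u -> un n t @[n --> U] --> u t.
Proof.
move=> unu; apply/cvgrPdist_lt => e e0; have [d d0] := unu t e e0.
by apply: filterS => n /(_ t); rewrite subrr normr0 distrC => /(_ d0).
Qed.

Lemma locally_uniform_itv un u (a b e : R) : locally_uniform un u -> 0 < e ->
  \forall n \near U, forall s, a <= s -> s <= b -> `|un n s - u s| < e.
Proof.
move=> unu e0; have [ab|ba] := leP a b; last first.
  by apply: filterE => n s as_ sb; have := lt_le_trans ba (le_trans as_ sb); rewrite ltxx.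
pose C x y := \forall n \near U, forall s, x <= s -> s <= y -> `|un n s - u s| < e.
apply: (@itv_ind _ C) => // [x y z _ _ _ _|t _].
  apply: filterS2 => n H1 H2 s xs sz.
  by have [sy|/ltW ys] := leP s y; [exact: H1|exact: H2].
have [d d0 H] := unu t e e0; exists d => // x y _ tx xt ty yt _.
by apply: filterS H => n H s xs sy; apply: H; rewrite ltr_norml; apply/andP; split; lra.
Qed.

(** Ascoli's theorem along an ultrafilter: boundedness at each point already yields the pointwise
    limit, with no diagonal extraction, and equicontinuity makes the limit continuous and the
    convergence locally uniform. *)
Lemma equicontinuous_ultra_limit un :
  (forall t, exists M : R, forall n, `|un n t| <= M) ->
  (forall t e : R, 0 < e -> exists2 d : R, 0 < d &
     forall n s, `|s - t| < d -> `|un n s - un n t| < e) ->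
  exists2 u, continuous u & locally_uniform un u.
Proof.
move=> unb une.
have /choice[u uP] t : exists l : R, un n t @[n --> U] --> l.
  by have [M HM] := unb t; apply: ultra_bounded_cvg HM.
have ue (t e : R) : 0 < e -> exists2 d : R, 0 < d &
    (forall n s, `|s - t| < d -> `|un n s - un n t| < e) /\
    forall s, `|s - t| < d -> `|u s - u t| <= e.
  move=> e0; have [d d0 H] := une t e e0; exists d => //; split=> // s st.
  apply: (cvgr_to_le (cvg_norm (cvgB (uP s) (uP t)))).
  by apply: filterE => n; apply/ltW/H.
exists u.
  move=> t; apply/continuous_epsP => e e0; have [|d d0 [_ H]] := ue t (e / 2); first lra.
  by exists d => // s st; have := H s st; lra.
move=> t e e0; have [|d d0 [H1 H2]] := ue t (e / 4); first lra.
exists d => //.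
have /cvgrPdist_lt/(_ (e / 4)) := uP t.
have e40 : 0 < e / 4 by lra.
move=> /(_ e40); apply: filterS => n; rewrite distrC => H s st.
have := H1 n s st; have := H2 s st.
rewrite (_ : un n s - u s = (un n s - un n t) + (un n t - u t) - (u s - u t)); last by ring.
have := ler_normB ((un n s - un n t) + (un n t - u t)) (u s - u t).
have := ler_normD (un n s - un n t) (un n t - u t).
lra.
Qed.

Lemma causal_inta_cvg F un u x y : causal_operator F ->
  (forall n, continuous (un n)) -> continuous u -> locally_uniform un u ->
  inta (F (un n)) x y @[n --> U] --> inta (F u) x y.
Proof.
move=> FC cun cu unu; apply/cvgrPdist_lt => e e0.
have [d d0 [m H]] := causal_continuous FC cu x y e0.
have := locally_uniform_itv (- m) m unu d0.
apply: filterS => n Hn; rewrite distrC -intaB; [|exact: causal_Lloc|exact: causal_Lloc].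
apply: le_lt_trans (H (un n) (cun n) Hn); apply: inta_norm.
by apply: LlocB; exact: causal_Lloc.
Qed.

End ultrafilter_limits.

(** * Tonelli approximations *)

Section continuity_helpers.
Context {R : realType}.
Implicit Types (u v : R -> R).

Lemma continuous_comp_min u (a : R) : continuous u -> continuous (fun t => u (Num.min t a)).
Proof.
move=> cu t; apply: (@continuous_comp _ _ _ (fun t => Num.min t a) u); last exact: cu.
by apply: continuous_min; [exact: cvg_id | exact: cvg_cst].
Qed.

Lemma continuous_min2 u v : continuous u -> continuous v ->
  continuous (fun t => Num.min (u t) (v t)).
Proof. by move=> cu cv t; apply: continuous_min; [exact: cu|exact: cv]. Qed.

Lemma continuous_max2 u v : continuous u -> continuous v ->
  continuous (fun t => Num.max (u t) (v t)).
Proof. by move=> cu cv t; apply: continuous_max; [exact: cu|exact: cv]. Qed.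

Lemma continuousD2 u v : continuous u -> continuous v ->
  continuous (fun t => u t + v t).
Proof. by move=> cu cv t; apply: cvgD; [exact: cu|exact: cv]. Qed.

Lemma continuousM2 u v : continuous u -> continuous v ->
  continuous (fun t => u t * v t).
Proof. by move=> cu cv t; apply: cvgM; [exact: cu|exact: cv]. Qed.

Lemma continuousN1 u : continuous u -> continuous (fun t => - u t).
Proof. by move=> cu t; apply: cvgN; exact: cu. Qed.

End continuity_helpers.

Section tonelli.
Context {R : realType}.
Notation mu := (@lebesgue_measure R).
Notation Lloc := (@locally_integrable R [set: R]).
Implicit Types (u v : R -> R).
Context (F : (R -> R) -> R -> R) (FC : causal_operator F).
Context (a : R) (psi : R -> R) (psi_cont : continuous psi).

Definition delay (d : R) u := fun s => u (s - d).

(** To the left of [t0], [psi] is 0 and [lam] is the constant before [a]; to the right, [lam] is 0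
    and [psi] is the part of the solution already found. *)
Definition tonelli_step (lam d : R) u t :=
  lam + psi (Num.min t a) + inta (F (delay d u)) a (Num.max t a).

Definition tonelli (lam d : R) k :=
  iter k (tonelli_step lam d) (fun t => lam + psi (Num.min t a)).

Lemma tonelliS lam d k t :
  tonelli lam d k.+1 t = tonelli_step lam d (tonelli lam d k) t.
Proof. by []. Qed.

Lemma continuous_delay d u : continuous u -> continuous (delay d u).
Proof.
move=> cu t; rewrite /delay; apply: (@continuous_comp _ _ _ (fun s => s - d) u); last exact: cu.
by apply: cvgB; [exact: cvg_id | exact: cvg_cst].
Qed.

Lemma continuous_tonelli lam d k : continuous (tonelli lam d k).
Proof.
elim: k => [|k IH] /=.
  by apply: continuousD2; [exact: cst_continuous|exact: continuous_comp_min].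
apply: continuousD2.
  by apply: continuousD2; [exact: cst_continuous|exact: continuous_comp_min].
by apply: continuous_prim; apply: causal_Lloc => //; exact: continuous_delay.
Qed.

Lemma Lloc_tonelli lam d k : Lloc (F (delay d (tonelli lam d k))).
Proof.
exact: (causal_Lloc FC (continuous_delay (d := d) (@continuous_tonelli lam d k))).
Qed.

(** Up to time [t] the step sees its argument only up to [t - d], so each iteration extends by [d]
    the interval on which the delayed equation holds. *)
Lemma tonelli_stable lam d k t : 0 <= d -> t <= a + k%:R * d ->
  tonelli lam d k.+1 t = tonelli lam d k t.
Proof.
move=> d0; elim: k t => [|k IH] t.
  rewrite mul0r addr0 => ta; rewrite /= /tonelli_step.
  by rewrite max_r// inta_xx addr0.
move=> tk; rewrite [LHS]tonelliS [RHS]tonelliS /tonelli_step; congr (_ + _).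
have [ta|at_] := leP t a; first by rewrite !inta_xx.
apply: causal_inta_eq => //.
- exact: (continuous_delay (d := d) (@continuous_tonelli lam d k.+1)).
- exact: (continuous_delay (d := d) (@continuous_tonelli lam d k)).
- move=> s st; apply: IH; move: tk; rewrite -natr1 mulrDl mul1r; lra.
Qed.

Lemma inta_max_sub h x y : Lloc h -> x <= y ->
  inta h a (Num.max y a) - inta h a (Num.max x a) = inta h (Num.max x a) (Num.max y a).
Proof.
move=> lh xy; rewrite (@inta_chasles _ h a (Num.max x a) (Num.max y a))//.
- by rewrite addrC addKr.
- by rewrite le_max lexx orbT.
- by rewrite ge_max !le_max xy lexx orbT.
Qed.

Lemma inta_max_le G x y : Lloc_nonneg G -> x <= y ->
  inta G (Num.max x a) (Num.max y a) <= inta G x y.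
Proof.
move=> [lG G0] xy; have [ya|ay] := leP y a; have [xa|ax] := leP x a => //.
- by rewrite inta_xx inta_ge0.
- by move: (lt_le_trans ax (le_trans xy ya)); rewrite ltxx.
- by apply: inta_subitv => //; [exact: ltW|apply: aeT].
Qed.

(** The bound involves neither [lam] nor [d] nor [k]: it gives the equicontinuity of all
    approximations. *)
Lemma tonelli_increment lam d k x y G : Lloc_nonneg G ->
  (forall v, continuous v -> \forall t \ae mu, t <= y -> `|F v t| <= G t) -> x <= y ->
  `|tonelli lam d k.+1 y - tonelli lam d k.+1 x| <=
  `|psi (Num.min y a) - psi (Num.min x a)| + inta G x y.
Proof.
move=> LG GB xy; rewrite /= /tonelli_step; set h := F _.
have lh : Lloc h by exact: Lloc_tonelli.
rewrite (_ : _ - _ = (psi (Num.min y a) - psi (Num.min x a)) +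
  (inta h a (Num.max y a) - inta h a (Num.max x a))); last by ring.
rewrite inta_max_sub//; apply: le_trans (ler_normD _ _) _; rewrite lerD2l.
have [ya|ay] := leP y a.
  rewrite max_r ?inta_xx ?normr0; last exact: le_trans ya.
  by apply: inta_ge0; case: LG.
apply: le_trans (_ : inta G (Num.max x a) y <= _); last first.
  by have := inta_max_le LG xy; rewrite [Num.max y a]max_l// ltW.
apply: inta_le_norm => //; first by case: LG.
have cv := continuous_delay (d := d) (@continuous_tonelli lam d k).
by apply: aeS (GB _ cv) => t H _ /H.
Qed.

(** An iterate arises from [lam] by finitely many continuous operations. Nothing similar is
    available for the limits, which need not be unique. *)
Lemma tonelli_param_continuous d k m e lam0 : 0 < e -> exists2 r : R, 0 < r &
  forall lam, `|lam - lam0| < r -> forall t, - m <= t -> t <= m ->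
    `|tonelli lam d k t - tonelli lam0 d k t| < e.
Proof.
elim: k m e => [|k IH] m e e0.
  exists e => // lam H t _ _ /=.
  by rewrite (_ : _ - _ = lam - lam0)//; ring.
have cv lam := continuous_delay (d := d) (@continuous_tonelli lam d k).
have e20 : 0 < e / 2 by lra.
have [d' d'0 [m' H]] := causal_continuous FC (cv lam0) a (Num.max m a) e20.
(* On [[-m', m']] the delayed function uses values of the iterate on a window larger by [|d|]. *)
have [r r0 Hr] := IH (m' + `|d|) d' d'0.
exists (Num.min r (e / 2)); first by rewrite lt_min r0.
move=> lam; rewrite lt_min => /andP[lr le2] t mt tm.
rewrite /= /tonelli_step -/(tonelli lam d k) -/(tonelli lam0 d k).
rewrite (_ : _ - _ = (lam - lam0) + (inta (F (delay d (tonelli lam d k))) a (Num.max t a) -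
  inta (F (delay d (tonelli lam0 d k))) a (Num.max t a))); last by ring.
apply: le_lt_trans (ler_normD _ _) _; rewrite [e]splitr ltrD//.
rewrite -intaB; [|exact: Lloc_tonelli|exact: Lloc_tonelli].
apply: le_lt_trans (inta_norm _ _ _) _.
  by apply: LlocB; exact: Lloc_tonelli.
apply: le_lt_trans (H (delay d (tonelli lam d k)) (cv lam) _).
  apply: inta_subitv.
  - by apply: Lloc_norm; apply: LlocB; exact: Lloc_tonelli.
  - by [].
  - by rewrite le_max lexx orbT.
  - by rewrite ge_max !le_max tm lexx orbT.
  - by apply: aeT.
move=> s ms sm; apply: Hr => //.
  by have := ler_norm d; lra.
by have := ler_norm (- d); rewrite normrN; lra.
Qed.

(** Provides the lower end for the intermediate value argument. *)
Lemma tonelli_zero d k t0 t : 0 <= d -> (forall t, psi t = 0) ->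
  (\forall t \ae mu, t <= t0 -> F (cst 0) t = 0) -> t <= t0 -> tonelli 0 d k t = 0.
Proof.
move=> d0 psi0 F0; elim: k t => [|k IH] t tt0 /=; first by rewrite psi0 addr0.
rewrite /tonelli_step psi0 !add0r -/(tonelli 0 d k).
have [ta|at_] := leP t a; first by rewrite inta_xx.
rewrite (@causal_inta_eq _ F _ (cst 0))//.
- rewrite (@eq_inta_ae _ _ (fun=> 0)).
  + by rewrite inta_cst ?mul0r// ltW.
  + by apply: causal_Lloc => //; exact: cst_continuous.
  + by apply: continuous_Lloc; exact: cst_continuous.
  + by apply: aeS F0 => s H _ st; apply: H; exact: le_trans tt0.
- exact: (continuous_delay (d := d) (@continuous_tonelli 0 d k)).
- exact: cst_continuous.
- by move=> s st; apply: IH; lra.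
Qed.

Section limit.
Context (U : set_system nat) {UU : UltraFilter U} (oo_U : \oo `<=` U).
Let PU : ProperFilter U := ultra_proper.
Existing Instance PU.

(** [(n + 1) ^ 2] steps of length [1 / (n + 1)] reach [a + n + 1], so the delayed equation
    eventually holds on every bounded interval. The additional iterate presents the function as a
    [tonelli_step]. *)
Definition tonelli_seq (lam : R) n := tonelli lam n.+1%:R^-1 (n.+1 ^ 2).+1.

Lemma tonelli_limit (lam : nat -> R) (M : R) : (forall n, `|lam n| <= M) ->
  exists u l, [/\ continuous u, lam n @[n --> U] --> l,
    locally_uniform U (fun n => tonelli_seq (lam n) n) u &
    forall t, u t = l + psi (Num.min t a) + inta (F u) a (Num.max t a)].
Proof.
move=> lamM.
have [l laml] := ultra_bounded_cvg (U := U) lamM.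
pose un n := tonelli_seq (lam n) n.
have cun n : continuous (un n) by exact: continuous_tonelli.
have [||u cu unu] := @equicontinuous_ultra_limit R U UU un.
- move=> t; have [G LG GB] := causal_bound FC (Num.max t a).
  exists (M + `|psi (Num.min t a)| + inta G a (Num.max t a)) => n.
  rewrite /un /tonelli_seq tonelliS /tonelli_step.
  apply: le_trans (ler_normD _ _) _; apply: lerD.
    by apply: le_trans (ler_normD _ _) _; rewrite lerD2r.
  apply: inta_le_norm; [exact: Lloc_tonelli|by case: LG|].
  have cv := continuous_delay (d := n.+1%:R^-1) (@continuous_tonelli (lam n) n.+1%:R^-1 (n.+1 ^ 2)).
  by apply: aeS (GB _ cv) => s H _ /H.
- move=> t e e0; have [G LG GB] := causal_bound FC (t + 1).
  have e20 : 0 < e / 2 by lra.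
  have [d1 d10 H1] := (continuous_epsP _ t).1 (@continuous_comp_min R psi a psi_cont t) _ e20.
  have [d2 d20 H2] := inta_small t LG.1 e20.
  exists (Num.min 1 (Num.min d1 d2)); first by rewrite !lt_min d10 d20 !andbT.
  move=> n s; rewrite !lt_min => /and3P[s1 sd1 sd2].
  move: (sd2); rewrite ltr_norml => /andP[sd3 sd4].
  have GE x y : inta (fun s => `|G s|) x y = inta G x y.
    by apply: eq_inta => r _ _; rewrite ger0_norm//; case: LG.
  have GB' y : y <= t + 1 -> forall v, continuous v ->
      \forall r \ae mu, r <= y -> `|F v r| <= G r.
    by move=> yt v cv; apply: aeS (GB v cv) => r H ry; apply: H; exact: le_trans yt.
  have psist := H1 s sd1.
  have s1' : s <= t + 1 by move: s1; rewrite ltr_norml => /andP[_ ?]; lra.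
  have t1 : t <= t + 1 by lra.
  have [st|/ltW ts] := leP s t.
    have := @tonelli_increment (lam n) n.+1%:R^-1 (n.+1 ^ 2) s t G LG (GB' t t1) st.
    rewrite distrC [X in _ <= X + _]distrC -/(tonelli_seq (lam n) n) -/(un n) => H.
    by have := H2 s t; rewrite GE => H'; apply: le_lt_trans H _; rewrite [e]splitr ltrD// H'//; lra.
  have := @tonelli_increment (lam n) n.+1%:R^-1 (n.+1 ^ 2) t s G LG (GB' s s1') ts.
  rewrite -/(tonelli_seq (lam n) n) -/(un n) => H.
  by have := H2 t s; rewrite GE => H'; apply: le_lt_trans H _; rewrite [e]splitr ltrD// H'//; lra.
exists u, l; split=> // t.
(* [vn n] is the argument at which [F] is evaluated in [un n]. It has the same limit [u]: the last
   two iterates agree near a given point for large [n], and the delay tends to 0. *)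
pose vn n := delay n.+1%:R^-1 (tonelli (lam n) n.+1%:R^-1 (n.+1 ^ 2)).
have cvn n : continuous (vn n).
  exact: (continuous_delay (@continuous_tonelli (lam n) n.+1%:R^-1 (n.+1 ^ 2))).
have vnu : locally_uniform U vn u.
  move=> s e e0; have [e20 e40] : 0 < e / 2 /\ 0 < e / 4 by split; lra.
  have [d1 d10 H1] := unu s _ e20.
  have [d2 d20 H2] := (continuous_epsP u s).1 (cu s) _ e40.
  pose d' := Num.min d1 d2 / 2.
  have d'0 : 0 < d' by rewrite divr_gt0 ?lt_min ?d10.
  have [d1' d2'] : 2 * d' <= d1 /\ 2 * d' <= d2.
    by rewrite /d' mulrC divfK ?pnatr_eq0// !ge_min !lexx orbT.
  exists d' => //.
  have nd : \forall n \near U, n.+1%:R^-1 < d'.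
    apply: oo_U; exact: near_infty_natSinv_lt (PosNum d'0).
  have ns : \forall n \near U, s + d' - a <= n.+1%:R.
    by apply: oo_U; have := nbhs_infty_ger (s + d' - a); apply: filterS => n h;
      apply: le_trans h _; rewrite ler_nat.
  move: H1 nd ns; apply: filterS3 => n H1 nd' ns r; rewrite ltr_norml => /andP[r1 r2].
  have n0 : 0 < n.+1%:R^-1 :> R by rewrite invr_gt0.
  have -> : vn n r = un n (r - n.+1%:R^-1).
    rewrite /vn /delay /un /tonelli_seq [RHS]tonelli_stable// ?ltW//.
    rewrite expnS expn1 natrM mulfK ?pnatr_eq0//.
    move: n0 ns nd'; move: (n.+1%:R^-1 : R) => x; move: (n.+1%:R : R) => y; lra.
  move: n0 nd'; move: (n.+1%:R^-1 : R) => x n0 nd'.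
  have K1 : `|un n (r - x) - u (r - x)| < e / 2.
    by apply: H1; rewrite ltr_norml; apply/andP; split; lra.
  have K2 : `|u (r - x) - u s| < e / 4.
    by apply: H2; rewrite ltr_norml; apply/andP; split; lra.
  have K3 : `|u r - u s| < e / 4.
    by apply: H2; rewrite ltr_norml; apply/andP; split; lra.
  move: K1 K2 K3; rewrite !ltr_norml => /andP[? ?] /andP[? ?] /andP[? ?].
  by apply/andP; split; lra.
have L1 : un n t @[n --> U] --> u t by exact: locally_uniform_cvg unu.
have L2 : un n t @[n --> U] --> l + psi (Num.min t a) + inta (F u) a (Num.max t a).
  apply: cvgD; first by apply: cvgD => //; exact: cvg_cst.
  exact: (@causal_inta_cvg R U UU F vn).
exact: cvg_unique L1 L2.
Qed.

End limit.
End tonelli.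

(** * Truncation *)

Section supnorm_theta.
Context {R : realType}.
Implicit Types (u v : R -> R).

Lemma continuous_theta (b : R) u : continuous u -> continuous (theta b u).
Proof. exact: continuous_comp_min. Qed.

Lemma theta_le (b : R) u t : t <= b -> theta b u t = u t.
Proof. by move=> tb; rewrite /theta min_l. Qed.

Lemma supnorm_le u r : (forall t, `|u t| <= r) -> supnorm u <= r.
Proof. by move=> ur; apply: ge_sup; [exists `|u 0|, 0|move=> _ [t _ <-]]. Qed.

Lemma le_supnorm u r t : (forall s, `|u s| <= r) -> `|u t| <= supnorm u.
Proof.
by move=> ur; apply: ub_le_sup; [exists r => _ [s _ <-]|exists t].
Qed.

Lemma supnorm_ge0 u : 0 <= supnorm u.
Proof.
rewrite /supnorm; have [ubu|nub] := pselect (has_ubound (range (fun t => `|u t|))).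
  by apply: le_trans (normr_ge0 (u 0)) _; apply: ub_le_sup => //; exists 0.
by rewrite sup_out// => -[].
Qed.

Lemma bounded_C0 D u r : continuous u -> (forall t, `|u t| <= r) ->
  (forall t, D (u t)) -> C0 D u.
Proof.
move=> cu ur Du; split=> //; exists r; split; first exact: num_real.
by move=> x rx t _; apply: le_trans (ur t) (ltW rx).
Qed.

End supnorm_theta.

Section clamp.
Context {R : realType}.
Implicit Types (u v lo hi : R -> R).

Definition clamp lo hi v : R -> R := fun t => Num.max (lo t) (Num.min (v t) (hi t)).

Lemma continuous_clamp lo hi v : continuous lo -> continuous hi -> continuous v ->
  continuous (clamp lo hi v).
Proof. by move=> cl ch cv; apply: continuous_max2 => //; exact: continuous_min2. Qed.

Lemma clamp_ge lo hi v t : lo t <= clamp lo hi v t.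
Proof. by rewrite /clamp le_max lexx. Qed.

Lemma clamp_le lo hi v t : lo t <= hi t -> clamp lo hi v t <= hi t.
Proof. by move=> lh; rewrite /clamp ge_max lh ge_min lexx orbT. Qed.

Lemma clamp_id lo hi v t : lo t <= v t -> v t <= hi t -> clamp lo hi v t = v t.
Proof. by move=> lv vh; rewrite /clamp min_l// max_r. Qed.

Lemma clamp_dist lo hi u v t : `|clamp lo hi u t - clamp lo hi v t| <= `|u t - v t|.
Proof.
have maxd (l x y : R) : `|Num.max l x - Num.max l y| <= `|x - y|.
  have N0 := normr_ge0 (x - y); have N1 := ler_norm (x - y).
  have N2 : y - x <= `|x - y| by rewrite distrC ler_norm.
  by rewrite ler_norml; have [?|?] := leP l x; have [?|?] := leP l y;
    apply/andP; split; lra.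
have mind (h x y : R) : `|Num.min x h - Num.min y h| <= `|x - y|.
  have N0 := normr_ge0 (x - y); have N1 := ler_norm (x - y).
  have N2 : y - x <= `|x - y| by rewrite distrC ler_norm.
  by rewrite ler_norml; have [?|?] := leP x h; have [?|?] := leP y h;
    apply/andP; split; lra.
exact: le_trans (maxd _ _ _) (mind _ _ _).
Qed.

Lemma clamp_norm lo hi v t : lo t <= hi t -> `|clamp lo hi v t| <= `|lo t| + `|hi t|.
Proof.
move=> lh; have := @clamp_ge lo hi v t; have := @clamp_le lo hi v t lh.
rewrite ler_norml => ? ?; have := ler_norm (hi t); have := ler_norm (- lo t).
have := normr_ge0 (hi t); have := normr_ge0 (lo t).
by rewrite normrN => ? ? ? ?; apply/andP; split; lra.
Qed.

End clamp.

Section truncated_equation.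
Context {R : realType}.
Notation mu := (@lebesgue_measure R).
Notation Lloc := (@locally_integrable R [set: R]).
Implicit Types (T : (R -> R) -> R -> R) (u v lo hi : R -> R).

Lemma positive_operator_le T u v : linear_operator T -> positive_operator T ->
  continuous u -> continuous v -> (forall t, u t <= v t) ->
  \forall t \ae mu, T u t <= T v t.
Proof.
move=> linT posT cu cv uv.
have cvu : continuous (fun s => 1 * v s + -1 * u s).
  by apply: continuousD2; apply: continuousM2 => //; exact: cst_continuous.
apply: (aeS2 _ (posT _ cvu _) (linT 1 (-1) v u cv cu)).
  by move=> t h1 h2; move: h1; rewrite h2; lra.
by move=> t; have := uv t; lra.
Qed.

Lemma linear_operatorZ T r u : linear_operator T -> continuous u ->
  \forall t \ae mu, T (fun s => r * u s) t = r * T u t.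
Proof.
move=> linT cu; apply: aeS (linT r 0 u u cu cu) => t.
rewrite mul0r addr0 => <-; congr (T _ t).
by apply/funext => s; rewrite mul0r addr0.
Qed.

Lemma linear_operator_cst T r : linear_operator T ->
  \forall t \ae mu, T (cst r) t = r * T (cst 1) t.
Proof.
move=> linT; have c1 : continuous (cst 1 : R -> R) by exact: cst_continuous.
apply: aeS (linear_operatorZ r linT c1) => t <-; congr (T _ t).
by apply/funext => s /=; rewrite mulr1.
Qed.

Lemma positive_operator_norm T u v : linear_operator T -> positive_operator T ->
  continuous u -> continuous v -> (forall t, `|u t| <= v t) ->
  \forall t \ae mu, `|T u t| <= T v t.
Proof.
move=> linT posT cu cv uv.
have cNu : continuous (fun s => -1 * u s).
  by apply: continuousM2 => //; exact: cst_continuous.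
have H1 := positive_operator_le linT posT cu cv (fun t => le_trans (ler_norm _) (uv t)).
have H2 : \forall t \ae mu, T (fun s => -1 * u s) t <= T v t.
  apply: positive_operator_le => // t; apply: le_trans (uv t).
  by rewrite mulN1r -normrN ler_norm.
apply: (aeS3 _ H1 H2 (linear_operatorZ (-1) linT cu)) => t h1 h2 h3.
by rewrite h3 in h2; rewrite ler_norml; apply/andP; split; lra.
Qed.

Lemma int_continuous_clamp T lo hi : continuous lo -> continuous hi ->
  int_continuous T -> int_continuous (fun v => T (clamp lo hi v)).
Proof.
move=> cl ch cT u cu a b e e0.
have [d d0 [m H]] := cT _ (continuous_clamp cl ch cu) a b e e0.
exists d => //; exists m => w cw wu; apply: H; first exact: continuous_clamp.
by move=> t mt tm; apply: le_lt_trans (wu t mt tm); exact: clamp_dist.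
Qed.

Lemma int_continuousD T1 T2 :
  (forall u, continuous u -> Lloc (T1 u)) -> (forall u, continuous u -> Lloc (T2 u)) ->
  int_continuous T1 -> int_continuous T2 ->
  int_continuous (fun v t => T1 v t + T2 v t).
Proof.
move=> L1 L2 c1 c2 u cu a b e e0.
have e20 : 0 < e / 2 by lra.
have [d1 d10 [m1 H1]] := c1 u cu a b _ e20.
have [d2 d20 [m2 H2]] := c2 u cu a b _ e20.
exists (Num.min d1 d2); first by rewrite lt_min d10.
exists (Num.max m1 m2) => w cw wu.
have K1 : inta (fun s => `|T1 w s - T1 u s|) a b < e / 2.
  apply: H1 => // t mt tm.
  have : `|w t - u t| < Num.min d1 d2.
    apply: wu; last by rewrite le_max tm.
    by apply: le_trans mt; rewrite lerN2 le_max lexx.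
  by rewrite lt_min => /andP[].
have K2 : inta (fun s => `|T2 w s - T2 u s|) a b < e / 2.
  apply: H2 => // t mt tm.
  have : `|w t - u t| < Num.min d1 d2.
    apply: wu; last by rewrite le_max tm orbT.
    by apply: le_trans mt; rewrite lerN2 le_max lexx orbT.
  by rewrite lt_min => /andP[].
rewrite [e]splitr; apply: le_lt_trans (ltrD K1 K2).
have LT1 : Lloc (fun s => T1 w s - T1 u s) by apply: LlocB; exact: L1.
have LT2 : Lloc (fun s => T2 w s - T2 u s) by apply: LlocB; exact: L2.
rewrite -intaD; [|exact: Lloc_norm|exact: Lloc_norm].
apply: le_inta_ae; [apply: Lloc_norm; apply: LlocB; apply: LlocD; auto| |].
  by apply: LlocD; exact: Lloc_norm.
apply: aeT => s _ _.
rewrite (_ : _ - _ = (T1 w s - T1 u s) + (T2 w s - T2 u s)); last by ring.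
exact: ler_normD.
Qed.

Lemma int_continuousN T : int_continuous T -> int_continuous (fun v t => - T v t).
Proof.
move=> cT u cu a b e e0; have [d d0 [m H]] := cT u cu a b e e0.
exists d => //; exists m => w cw wu.
rewrite (@eq_inta _ _ (fun s => `|T w s - T u s|)); first exact: H.
by move=> s _ _; rewrite -opprB normrN opprK addrC.
Qed.

Context (l0 l1 f : (R -> R) -> R -> R).
Hypotheses (l0_lin : linear_operator l0) (l0_pos : positive_operator l0)
  (l1_lin : linear_operator l1) (l1_pos : positive_operator l1)
  (f_car : local_caratheodory f) (l0_V : V l0) (l1_V : V l1) (f_V : V f).

(** Separate levels for the linear part and for [f], since to the left of [t0] the two are truncated
    differently. *)
Definition truncated lo1 hi1 lo2 hi2 v t :=
  l0 (clamp lo1 hi1 v) t - l1 (clamp lo1 hi1 v) t + f (clamp lo2 hi2 v) t.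

Lemma V_Lloc T u : V T -> continuous u -> Lloc (T u).
Proof. by move=> /(_ 0)[[H _] _]; exact: H. Qed.

Lemma V_eq T z u v : V T -> continuous u -> continuous v ->
  (forall s, s <= z -> u s = v s) -> \forall t \ae mu, t <= z -> T u t = T v t.
Proof. by move=> /(_ z)[_ H]; exact: H. Qed.

Lemma truncated_causal lo1 hi1 lo2 hi2 :
  continuous lo1 -> continuous hi1 -> continuous lo2 -> continuous hi2 ->
  (forall t, lo1 t <= hi1 t) -> (forall t, lo2 t <= hi2 t) ->
  (forall b, exists2 r : R, 0 < r & forall t, t <= b -> `|lo2 t| + `|hi2 t| <= r) ->
  causal_operator (truncated lo1 hi1 lo2 hi2).
Proof.
move=> cl1 ch1 cl2 ch2 lh1 lh2 lhb.
have cc1 u : continuous u -> continuous (clamp lo1 hi1 u) by exact: continuous_clamp.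
have cc2 u : continuous u -> continuous (clamp lo2 hi2 u) by exact: continuous_clamp.
have L0 u : continuous u -> Lloc (l0 (clamp lo1 hi1 u)).
  by move=> cu; apply: V_Lloc => //; exact: cc1.
have L1 u : continuous u -> Lloc (fun t => - l1 (clamp lo1 hi1 u) t).
  by move=> cu; apply: locally_integrableN; apply: V_Lloc => //; exact: cc1.
have L2 u : continuous u -> Lloc (f (clamp lo2 hi2 u)).
  by move=> cu; apply: V_Lloc => //; exact: cc2.
have cV T : V T -> int_continuous T.
  by move=> /(_ 0)[cT _]; exact: continuous_operator_int.
split.
- by move=> u cu; apply: LlocD; [apply: LlocD; [exact: L0|exact: L1]|exact: L2].
- apply: int_continuousD.
  + by move=> u cu; apply: LlocD; [exact: L0|exact: L1].
  + by [].
  + apply: int_continuousD => //; first exact: int_continuous_clamp (cV _ l0_V).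
    by apply: int_continuousN; exact: int_continuous_clamp (cV _ l1_V).
  + exact: int_continuous_clamp (cV _ f_V).
- move=> z u v cu cv uv.
  have E1 s : s <= z -> clamp lo1 hi1 u s = clamp lo1 hi1 v s.
    by move=> sz; rewrite /clamp uv.
  have E2 s : s <= z -> clamp lo2 hi2 u s = clamp lo2 hi2 v s.
    by move=> sz; rewrite /clamp uv.
  apply: (aeS3 _ (V_eq l0_V (cc1 u cu) (cc1 v cv) E1)
    (V_eq l1_V (cc1 u cu) (cc1 v cv) E1) (V_eq f_V (cc2 u cu) (cc2 v cv) E2)).
  by move=> t h1 h2 h3 tz; rewrite /truncated h1// h2// h3.
- move=> b; have [r r0 Hr] := lhb b; have [qr [Lq q0] Hq] := f_car r0.
  pose k t := `|lo1 t| + `|hi1 t|.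
  have ck : continuous k.
    by apply: continuousD2 => t; apply: cvg_norm; [exact: cl1|exact: ch1].
  exists (fun t => `|l0 k t| + `|l1 k t| + qr t).
    split; last by move=> t; rewrite !addr_ge0.
    by apply: LlocD => //; apply: LlocD; apply: Lloc_norm; exact: V_Lloc.
  move=> v cv.
  (* The Caratheodory bound concerns functions bounded on the whole line, whereas the levels are
     bounded only on left half-lines; hence the function is frozen after [b]. *)
  pose w := theta b (clamp lo2 hi2 v).
  have cw : continuous w by exact: continuous_theta (cc2 v cv).
  have wr t : `|w t| <= r.
    by apply: le_trans (clamp_norm _ _) _ => //; apply: Hr; rewrite ge_min lexx orbT.
  have fw : \forall t \ae mu, t <= b -> `|f (clamp lo2 hi2 v) t| <= qr t.
    have Hw : C0 [set: R] w by exact: bounded_C0 wr _.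
    have E s : s <= b -> clamp lo2 hi2 v s = w s by move=> sb; rewrite /w theta_le.
    apply: (aeS2 _ (Hq w Hw (supnorm_le wr)) (V_eq f_V (cc2 v cv) cw E)).
    by move=> t h1 h2 tb; rewrite h2.
  have kv t : `|clamp lo1 hi1 v t| <= k t by exact: clamp_norm.
  apply: (aeS3 _ (positive_operator_norm l0_lin l0_pos (cc1 v cv) ck kv)
     (positive_operator_norm l1_lin l1_pos (cc1 v cv) ck kv) fw).
  move=> t h0 h1 h2 tb; rewrite /truncated.
  apply: le_trans (ler_normD _ _) _; apply: lerD (h2 tb).
  apply: le_trans (ler_normB _ _) _; apply: lerD.
    exact: le_trans h0 (ler_norm _).
  exact: le_trans h1 (ler_norm _).
Qed.

End truncated_equation.

(** * Derivatives almost everywhere and integrated differential inequalities *)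

Section derivatives_of_primitives.
Context {R : realType}.
Notation mu := (@lebesgue_measure R).
Notation Lloc := (@locally_integrable R [set: R]).
Implicit Types (h u : R -> R).

Lemma is_derive_inta h a : Lloc h ->
  \forall t \ae mu, a < t -> is_derive (t : R) (1 : R) (fun s => inta h a s) (h t).
Proof.
move=> lh; have := lebesgue_differentiation lh.
apply: aeS => t ht at_.
have tt1 : t < t + 1 by lra.
have := @FTC1_lebesgue_pt R h (BLeft a) t (t + 1) tt1 (Lloc_integrable a (t + 1) lh).
by rewrite /= lte_fin => /(_ at_ ht) [d1 d2];
  split => //; rewrite -derive1E.
Qed.

(** The countably many base points [-n] share one exceptional null set, and every [t] lies to the
    right of one of them. *)
Lemma is_derive_primitive h u : Lloc h ->
  (forall x y, x <= y -> u y - u x = inta h x y) ->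
  \forall t \ae mu, is_derive (t : R) (1 : R) u (h t).
Proof.
move=> lh uh.
have := ae_foralln (fun n => is_derive_inta (- n%:R) lh).
apply: aeS => t Ht.
have [n nt] : exists n : nat, - t < n%:R.
  exists (Num.bound `|t|); apply: le_lt_trans (archi_boundP (normr_ge0 t)).
  by rewrite -normrN ler_norm.
have tn : - n%:R < t by lra.
have {}Ht := Ht n tn.
apply: (near_eq_is_derive (f := fun s => inta h (- n%:R) s + u (- n%:R))).
  have : \forall s \near t, - n%:R < s by exact: lt_nbhsr.
  by apply: filterS => s ns; rewrite -uh ?ltW// subrK.
rewrite -[h t]addr0; exact: is_deriveD.
Qed.

Lemma absolutely_continuous_epsP u a b : absolutely_continuous_on a b u ->
  forall e : R, 0 < e -> exists2 d : R, 0 < d &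
    forall x y, a <= x -> x <= b -> a <= y -> y <= b -> `|x - y| < d -> `|u x - u y| < e.
Proof.
move=> ACu e e0; have [d d0 H] := ACu e e0; exists d => //.
have key x y : a <= x -> x < y -> y <= b -> y - x < d -> `|u y - u x| < e.
  move=> ax xy yb yxd; have := H 1%N (fun=> x) (fun=> y).
  rewrite !big_ord1; apply => //.
  by move=> i j _ _ _; rewrite !ord1.
move=> x y ax xb ay yb; have [xy|yx|->] := ltgtP x y.
- by rewrite distrC gtr0_norm ?subr_gt0// => h; rewrite distrC; exact: key.
- by rewrite gtr0_norm ?subr_gt0// => h; exact: key.
- by rewrite !subrr !normr0.
Qed.

Lemma continuous_theta_AC (t0 : R) u : ACloc `]-oo, t0] u -> continuous (theta t0 u).
Proof.
move=> ACu t; apply/continuous_epsP => e e0.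
pose a := Num.min t t0 - 1.
have at0 : a <= t0 by rewrite /a lerBlDr; apply: le_trans (_ : t0 <= _); [rewrite ge_min lexx orbT|lra].
have [|d d0 H] := absolutely_continuous_epsP (ACu a t0 at0 _) e0.
  by move=> s /=; rewrite !in_itv/= => /andP[].
exists (Num.min 1 d); first by rewrite lt_min d0 ltr01.
move=> s; rewrite lt_min => /andP[s1 sd].
have dm : `|Num.min s t0 - Num.min t t0| <= `|s - t|.
  have N0 := normr_ge0 (s - t); have N1 := ler_norm (s - t).
  have N2 : t - s <= `|s - t| by rewrite distrC ler_norm.
  by rewrite ler_norml; have [?|?] := leP s t0; have [?|?] := leP t t0;
    apply/andP; split; lra.
apply: H; rewrite ?ge_min ?lexx ?orbT//.
- by move: (le_lt_trans dm s1); rewrite /a ltr_norml => /andP[? _]; lra.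
- by rewrite /a; lra.
- exact: le_lt_trans dm sd.
Qed.

(** Subtracting a primitive of [h] reduces this to a nonpositive derivative. It puts the
    differential inequality for [gamma] into integrated form. *)
Lemma AC_derive1_le u h x y : x <= y -> Lloc h -> absolutely_continuous_on x y u ->
  (\forall t \ae mu, x < t -> t < y -> derivable u (t : R) 1 /\ derive1 u t <= h t) ->
  u y - u x <= inta h x y.
Proof.
move=> xy lh ACu u'.
pose k t := inta h x t.
have kE s t : x <= s -> s <= t -> t <= y -> k t - k s = inta h s t.
  by move=> xs st _; rewrite /k (inta_chasles lh xs st) addrC addKr.
have ACk := ACB ACu (AC_primitive lh kE).
have := AC_derive1_le0 xy ACk _.
rewrite /k inta_xx subr0 => H.
suff : u y - inta h x y <= u x by lra.
apply: H; apply: (aeS2 _ u' (is_derive_inta x lh)) => t H1 H2 xt ty.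
have [du u'h] := H1 xt ty; have [dk k'h] := H2 xt.
split; first exact: derivableB.
by rewrite derive1E deriveB// k'h -derive1E; lra.
Qed.

End derivatives_of_primitives.

(** * Estimates and existence to the left of t0 *)

Section level_points.
Context {R : realType}.
Implicit Types (u : R -> R) (a b c : R).

Lemma last_point_le u a b c : continuous u -> a <= b -> u a <= c ->
  exists x, [/\ a <= x, x <= b, u x <= c & forall y, x < y -> y <= b -> c < u y].
Proof.
move=> cu ab uac; pose S := [set x | [/\ a <= x, x <= b & u x <= c]].
have Sa : S a by [].
have Sb : has_ubound S by exists b => x [].
have hsS : has_sup S by split=> //; exists a.
exists (sup S); split.
- exact: ub_le_sup.
- by apply: ge_sup; [exists a|move=> x []].
- rewrite leNgt; apply/negP => cs.
  have [|d d0 H] := (continuous_epsP u _).1 (cu (sup S)) (u (sup S) - c); first lra.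
  have [x [ax xb ux] xd] := sup_adherent d0 hsS.
  have xs : x <= sup S by apply: ub_le_sup.
  have : `|u x - u (sup S)| < u (sup S) - c.
    by apply: H; rewrite ltr_norml; apply/andP; split; lra.
  by rewrite ltr_norml => /andP[? ?]; lra.
- move=> y sy yb; rewrite ltNge; apply/negP => uy.
  have : y <= sup S.
    apply: ub_le_sup => //; split=> //; apply: le_trans (ltW sy).
    exact: ub_le_sup.
  lra.
Qed.

Lemma first_point_eq u a b c : continuous u -> a <= b -> u a <= c -> c <= u b ->
  exists x, [/\ a <= x, x <= b, u x = c & forall y, a <= y -> y <= x -> u y <= c].
Proof.
move=> cu ab uac cub.
(* Reversing both time and values turns the first point at level [c] into a last point. *)
pose phi (t : R) := - u (- t).
have cphi : continuous phi.
  apply: continuousN1 => t; apply: (@continuous_comp _ _ _ (fun t => - t) u).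
    by apply: cvgN; exact: cvg_id.
  exact: cu.
have ba : - b <= - a by rewrite lerN2.
have phib : phi (- b) <= - c by rewrite /phi opprK lerN2.
have [x [bx xa phix Hx]] := last_point_le cphi ba phib.
have ax : a <= - x by rewrite lerNr.
have xb : - x <= b by rewrite lerNl.
have ucx : c <= u (- x) by rewrite /phi lerN2 in phix.
have Hlt y : a <= y -> y < - x -> u y < c.
  move=> ay yx; have : - c < phi (- y) by apply: Hx; [rewrite ltrNr|rewrite lerN2].
  by rewrite /phi opprK ltrN2.
have uxc : u (- x) = c.
  apply/eqP; rewrite eq_le ucx andbT leNgt; apply/negP => cux.
  have [|d d0 H] := (continuous_epsP u _).1 (cu (- x)) (u (- x) - c).
    by rewrite subr_gt0.
  have [xa'|ax'] := eqVneq a (- x).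
    by rewrite -xa' in cux; have := lt_le_trans cux uac; rewrite ltxx.
  have ax2 : a < - x by rewrite lt_neqAle ax' ax.
  pose y := Num.max a (- x - d / 2).
  have ay : a <= y by rewrite le_max lexx.
  have yx : y < - x by rewrite gt_max ax2 /=; lra.
  have yd : - x - d / 2 <= y by rewrite le_max lexx orbT.
  have : `|u y - u (- x)| < u (- x) - c.
    by apply: H; rewrite ltr_norml; apply/andP; split; lra.
  rewrite ltr_norml => /andP[h _].
  have := Hlt y ay yx; lra.
exists (- x); split=> // y ay; rewrite le_eqVlt => /predU1P[->|yx]; first by rewrite uxc.
exact/ltW/Hlt.
Qed.

End level_points.

Section left_estimates.
Context {R : realType}.
Notation mu := (@lebesgue_measure R).
Notation Lloc := (@locally_integrable R [set: R]).
Context (l0 l1 f : (R -> R) -> R -> R).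
Hypotheses (l0_lin : linear_operator l0) (l0_pos : positive_operator l0)
  (l1_lin : linear_operator l1) (l1_pos : positive_operator l1)
  (f_car : local_caratheodory f) (l0_V : V l0) (l1_V : V l1) (f_V : V f).
Context (t0 kappa B : R) (sigma : R -> R).
Hypotheses (sigma_Sigma : Sigma sigma) (l0_Vsigma : V_sigma t0 sigma l0).
Hypotheses (kappa_gt0 : 0 < kappa) (B_gt0 : 0 < B).
Hypothesis f_ge0 : forall v : R -> R, C0 `[0, kappa] v ->
     \forall t \ae mu, t <= t0 -> 0 <= f v t.
Context (gam : R -> R) (M : R).
Hypotheses (gam_cont : continuous gam) (gam_gt0 : forall t, 0 < gam t).
Hypothesis gam_le : forall x y, x <= y -> y <= t0 ->
  gam y - gam x <= - inta (l1 gam) x y.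

Let p t := l1 gam t / gam t.
Hypothesis p_le : \forall t \ae mu, t <= t0 -> p t <= l0 (cst 1) t.
Hypothesis p_M : forall t, t <= t0 -> inta p (sigma t) t <= M.

Notation F := (truncated l0 l1 f (cst 0) (cst B) (cst 0) (cst kappa)).
Notation clampB := (clamp (cst 0) (cst B)).

Lemma left_causal : causal_operator F.
Proof.
apply: truncated_causal => //; try exact: cst_continuous; try by move=> t /=; exact: ltW.
by move=> b; exists kappa => // t _ /=; rewrite normr0 add0r gtr0_norm.
Qed.

Lemma Lloc_l1gam : Lloc (l1 gam).
Proof. exact: V_Lloc. Qed.

Lemma Lloc_p : Lloc p.
Proof.
apply: LlocM; first exact: Lloc_l1gam.
by move=> t; apply: cvgV; [rewrite gt_eqF|exact: gam_cont].
Qed.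

Lemma l1gam_ge0 : \forall t \ae mu, 0 <= l1 gam t.
Proof. by apply: l1_pos => // t; exact: ltW. Qed.

Lemma p_ge0 : \forall t \ae mu, 0 <= p t.
Proof. by apply: aeS l1gam_ge0 => t H; rewrite /p divr_ge0// ltW. Qed.

Lemma gam_nonincreasing x y : x <= y -> y <= t0 -> gam y <= gam x.
Proof.
move=> xy yt0; have := gam_le xy yt0.
have : 0 <= inta (l1 gam) x y.
  by apply: inta_ge0_ae; [exact: Lloc_l1gam|apply: aeS l1gam_ge0].
lra.
Qed.

Lemma clampB_ge0 u t : 0 <= clampB u t.
Proof. exact: (@clamp_ge R (cst 0) (cst B) u t). Qed.

Lemma clampB_leB u t : clampB u t <= B.
Proof. by apply: (@clamp_le R (cst 0) (cst B) u t); exact: ltW. Qed.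

Lemma continuous_clampB u : continuous u -> continuous (clampB u).
Proof. by move=> cu; apply: continuous_clamp => //; exact: cst_continuous. Qed.

Record left_solution (a : R) (u : R -> R) : Prop := LeftSolution {
  left_cont : continuous u;
  left_eq : forall x y, a <= x -> x <= y -> y <= t0 -> u y - u x = inta (F u) x y;
  left_const : forall t, t <= a -> u t = u a;
  left_init : 0 <= u a }.

Context (a : R) (u : R -> R) (a_t0 : a <= t0) (lu : left_solution a u).
Let w := clampB u.
Let cu := left_cont lu.
Let cw : continuous w := continuous_clampB cu.

Lemma Lloc_l0w : Lloc (l0 w). Proof. exact: V_Lloc. Qed.

Lemma inta_l0w_ge0 x y : 0 <= inta (l0 w) x y.
Proof.
apply: inta_ge0_ae; first exact: Lloc_l0w.
have := l0_pos cw (fun t => clampB_ge0 u t).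
by apply: aeS.
Qed.

Lemma left_lower x y m : a <= x -> x <= y -> y <= t0 -> 0 <= m ->
  (forall s, s <= y -> w s <= m * gam s) ->
  inta (l0 w) x y - m * inta (l1 gam) x y <= u y - u x.
Proof.
move=> ax xy yt0 m0 wm; rewrite (left_eq lu ax xy yt0).
rewrite -intaZ; last exact: Lloc_l1gam.
rewrite -intaB; [|exact: Lloc_l0w|by apply: LlocZ; exact: Lloc_l1gam].
apply: le_inta_ae.
- by apply: LlocB; [exact: Lloc_l0w|by apply: LlocZ; exact: Lloc_l1gam].
- exact: (causal_Lloc left_causal cu).
have cmg : continuous (fun s => m * gam s).
  by apply: continuousM2 => //; exact: cst_continuous.
(* [w <= m * gam] is known only up to [y]; [w'] satisfies it everywhere and agrees with [w] up to
   [y]. *)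
pose w' s := Num.min (w s) (m * gam s).
have cw' : continuous w' by exact: continuous_min2.
have E s : s <= y -> w s = w' s by move=> sy; rewrite /w' min_l// wm.
have H1 : \forall t \ae mu, l1 w' t <= m * l1 gam t.
  have := positive_operator_le l1_lin l1_pos cw' cmg.
  move=> /(_ _)H; apply: (aeS2 _ (H _) (linear_operatorZ m l1_lin gam_cont)).
    by move=> t h1 <-.
  by move=> t; rewrite /w' ge_min lexx orbT.
have H2 := V_eq l1_V cw cw' E.
have cv : continuous (clamp (cst 0) (cst kappa) u).
  by apply: continuous_clamp => //; exact: cst_continuous.
have H3 : \forall t \ae mu, t <= t0 -> 0 <= f (clamp (cst 0) (cst kappa) u) t.
  apply: f_ge0; apply: (bounded_C0 (r := kappa)) => // t.
    rewrite ger0_norm; last exact: (@clamp_ge R (cst 0) (cst kappa) u t).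
    by apply: (@clamp_le R (cst 0) (cst kappa) u t); exact: ltW.
  rewrite /= in_itv /=; apply/andP; split; first exact: (@clamp_ge R (cst 0) (cst kappa) u t).
  by apply: (@clamp_le R (cst 0) (cst kappa) u t); exact: ltW.
apply: (aeS3 _ H1 H2 H3) => t h1 h2 h3 xt ty.
rewrite /truncated -/w h2//.
by have := h3 (le_trans ty yt0); lra.
Qed.

(* After the point where [w / gam] reaches its maximum [m] on [a, t], the
   function [u - m * gam] is nondecreasing. *)
Lemma left_ratio t : t <= t0 ->
  0 <= u t /\ forall s, s <= t -> w s * gam t <= w t * gam s.
Proof.
move=> tt0; have [at_|ta] := leP a t; last first.
  split=> [|s st]; first by rewrite (left_const lu (ltW ta)) (left_init lu).
  have -> : w s = w t.
    rewrite /w /clamp (left_const lu (ltW ta)) (left_const lu)//.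
    exact: le_trans (ltW ta).
  by rewrite ler_wpM2l ?clampB_ge0// gam_nonincreasing.
have cwg : {within `[a, t], continuous (fun s => w s / gam s)}.
  apply: continuous_subspaceT => s; apply: cvgM; first exact: cw.
  by apply: cvgV; [rewrite gt_eqF|exact: gam_cont].
have [s0] := EVT_max at_ cwg; rewrite in_itv /= => /andP[as0 s0t] Hmax.
pose m := w s0 / gam s0.
have m0 : 0 <= m by rewrite /m divr_ge0 ?clampB_ge0// ltW.
have wm s : s <= t -> w s <= m * gam s.
  move=> st; have [as_|sa] := leP a s.
    by rewrite -ler_pdivrMr//; apply: Hmax; rewrite in_itv /= as_ st.
  have -> : w s = w a by rewrite /w /clamp (left_const lu (ltW sa)).
  apply: le_trans (_ : m * gam a <= _).
    by rewrite -ler_pdivrMr//; apply: Hmax; rewrite in_itv /= lexx at_.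
  by rewrite ler_wpM2l// gam_nonincreasing// ltW.
have low x : a <= x -> x <= t -> m * (gam t - gam x) <= u t - u x.
  move=> ax xt; apply: le_trans (left_lower ax xt tt0 m0 wm).
  have := ler_wpM2l m0 (gam_le xt tt0); have := inta_l0w_ge0 x t; lra.
have utm : m * gam t <= u t.
  have [us0|us0] := leP 0 (u s0).
    have wu : w s0 <= u s0 by rewrite /w /clamp /= ge_max us0 ge_min lexx.
    have : m * gam s0 = w s0 by rewrite /m divfK// gt_eqF.
    by have := low s0 as0 s0t; rewrite mulrBr; lra.
  (* If [u s0 < 0], the maximal ratio [m] is 0, and the lower bound reduces to [u t >= u a >= 0]. *)
  have ws0 : w s0 = 0.
    by rewrite /w /clamp /= max_l// ge_min ltW.
  have mE : m = 0 by rewrite /m ws0 mul0r.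
  by have := low a (lexx a) at_; have := left_init lu; rewrite mE !mul0r; lra.
split; first by apply: le_trans utm; rewrite mulr_ge0// ltW.
have wtm : m * gam t <= w t.
  rewrite /w /clamp /= le_max le_min utm /=; apply/orP; right.
  apply: le_trans (clampB_leB u s0).
  rewrite -/w (_ : w s0 = m * gam s0); last by rewrite /m divfK// gt_eqF.
  by rewrite ler_wpM2l// gam_nonincreasing.
move=> s st; apply: le_trans (_ : m * gam s * gam t <= _).
  by rewrite ler_wpM2r ?wm// ltW.
by rewrite mulrAC ler_wpM2r// ltW.
Qed.

(** Since [w / gam] is nondecreasing, [l1 w] is at most [w y / gam y * l1 gam] up to [y], and
    [l1 gam <= gam x * p] on [[x, y]]. On short intervals [w y / gam y * gam x] is close to [w y],
    so this is the local input of the backward Gronwall inequality for [w - r]. *)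
Lemma left_core x y r : a <= x -> x <= y -> y <= t0 -> r <= w x ->
  r * inta p x y <= inta (l0 w) x y ->
  w x - w y <= inta p x y * (w y / gam y * gam x - r).
Proof.
move=> ax xy yt0 rw l0r.
pose m := w y / gam y.
have m0 : 0 <= m by rewrite /m divr_ge0 ?clampB_ge0// ltW.
have wm s : s <= y -> w s <= m * gam s.
  move=> sy; rewrite /m mulrAC ler_pdivlMr//.
  by have [_] := left_ratio yt0; exact.
have low := left_lower ax xy yt0 m0 wm.
have p0 : 0 <= inta p x y.
  by apply: inta_ge0_ae; [exact: Lloc_p|apply: aeS p_ge0].
have l1p : inta (l1 gam) x y <= gam x * inta p x y.
  rewrite -intaZ; last exact: Lloc_p.
  apply: le_inta_ae; [exact: Lloc_l1gam|by apply: LlocZ; exact: Lloc_p|].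
  apply: aeS p_ge0 => t pt xt ty.
  rewrite (_ : l1 gam t = gam t * p t); last by rewrite /p mulrC divfK// gt_eqF.
  by rewrite ler_wpM2r// gam_nonincreasing// (le_trans ty).
have Q0 : 0 <= inta p x y * (m * gam x - r).
  by rewrite mulr_ge0// subr_ge0; apply: le_trans rw (wm x xy).
have uQ : u x - u y <= inta p x y * (m * gam x - r).
  by have := ler_wpM2l m0 l1p; rewrite mulrBr; lra.
rewrite -/m; have [ux0 _] := left_ratio (le_trans xy yt0).
have [uy0 _] := left_ratio yt0.
(* Where the truncation is active, [w y] has the largest possible value [B] and the left-hand side
   is nonpositive. *)
have [By|yB] := leP B (u y).
  apply: le_trans Q0; rewrite subr_le0.
  have -> : w y = B by rewrite /w /clamp /= min_r// max_r// ltW.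
  exact: clampB_leB.
have -> : w y = u y by rewrite /w clamp_id//= ltW.
apply: le_trans uQ; rewrite lerD2r /w /clamp /= max_r ?ge_min ?lexx//.
by rewrite le_min ux0 ltW.
Qed.

(** Applied with [r] a minimum of [w], where the condition on [l0] comes from [p <= l0 1], and with
    [r = 0], where it is mere positivity. *)
Lemma left_gronwall s t r : a <= s -> s <= t -> t <= t0 ->
  (forall x, s <= x -> x <= t -> r <= w x) ->
  (forall x y, s <= x -> x <= y -> y <= t -> r * inta p x y <= inta (l0 w) x y) ->
  w s - r <= (w t - r) * expR (inta p s t).
Proof.
move=> as_ st tt0 rw l0r.
pose P x := inta p s (Num.max x s).
have PE x y : s <= x -> x <= y -> P y - P x = inta p x y.
  move=> sx xy; rewrite /P !max_l//; last exact: le_trans xy.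
  by rewrite (inta_chasles Lloc_p sx xy) addrC addKr.
rewrite (_ : inta p s t = P t - P s); last by rewrite PE.
apply: (@gronwall_backward _ (fun x => w x - r)) => //.
- by move=> x; apply: cvgB; [exact: cw|exact: cvg_cst].
- by move=> x sx xt; rewrite subr_ge0 rw.
- move=> x y sx xy yt; rewrite -subr_ge0 PE//.
  by apply: inta_ge0_ae; [exact: Lloc_p|apply: aeS p_ge0].
move=> q e sq qt e0.
pose phi x := w x / gam x.
have cphi : continuous phi.
  move=> x; apply: cvgM; first exact: cw.
  by apply: cvgV; [rewrite gt_eqF|exact: gam_cont].
have phi0 : 0 <= phi q by rewrite /phi divr_ge0 ?clampB_ge0// ltW.
have D0 : 0 < 1 + phi q + gam q by have := gam_gt0 q; lra.
(* Chosen so that [(phi q + eta) * (gam q + eta) <= w q + e], where [phi q * gam q = w q] and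
   [eta * eta <= eta]. *)
pose eta := Num.min 1 (e / (1 + phi q + gam q)).
have eta0 : 0 < eta by rewrite lt_min ltr01 divr_gt0.
have eta1 : eta <= 1 by rewrite ge_min lexx.
have etae : eta * (1 + phi q + gam q) <= e.
  by rewrite -ler_pdivlMr// ge_min lexx orbT.
have [d1 d10 H1] := (continuous_epsP phi q).1 (cphi q) eta eta0.
have [d2 d20 H2] := (continuous_epsP gam q).1 (@gam_cont q) eta eta0.
exists (Num.min d1 d2); first by rewrite lt_min d10.
move=> x y sx; rewrite ltrBlDr -ltrBlDl lt_min => /andP[x1 x2] xq qy.
rewrite -ltrBlDl lt_min => /andP[y1 y2] yt.
have xy := le_trans xq qy.
rewrite PE// opprB addrA subrK.
apply: le_trans (_ : inta p x y * (w y / gam y * gam x - r) <= _).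
  apply: left_core => //; [exact: le_trans sx|exact: le_trans tt0| |exact: l0r].
  by apply: rw => //; exact: le_trans yt.
rewrite ler_wpM2l//.
  by apply: inta_ge0_ae; [exact: Lloc_p|apply: aeS p_ge0].
have K1 : phi y < phi q + eta.
  have : `|phi y - phi q| < eta by apply: H1; rewrite ltr_norml; apply/andP; split; lra.
  by rewrite ltr_norml => /andP[_ ?]; lra.
have K2 : gam x < gam q + eta.
  have : `|gam x - gam q| < eta by apply: H2; rewrite ltr_norml; apply/andP; split; lra.
  by rewrite ltr_norml => /andP[_ ?]; lra.
have phiy0 : 0 <= phi y by rewrite /phi divr_ge0 ?clampB_ge0// ltW.
have := ler_pM phiy0 (ltW (gam_gt0 x)) (ltW K1) (ltW K2).
have wq : phi q * gam q = w q by rewrite /phi divfK// gt_eqF.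
have : eta * eta <= eta * 1 by rewrite ler_wpM2l// ltW.
rewrite -/(phi y); move: etae; rewrite !mulrDr !mulrDl wq; lra.
Qed.

(* Let [w t] be the minimum of [w] on [s, t0] and [tau] the last point of [s, t]
   with [sigma tau <= s]. After [tau] the delay does not reach before [s], where
   [w >= w t], so Gronwall for [w - w t] gives [w tau = w t]; between [s] and
   [tau] the integral of [p] is at most [M]. *)
Lemma left_upper s : s <= t0 -> w s <= w t0 * expR M.
Proof.
wlog as_ : s / a <= s.
  move=> H st0; have [as_|sa] := leP a s; first exact: H.
  have -> : w s = w a by rewrite /w /clamp (left_const lu (ltW sa)).
  exact: H.
move=> st0.
have [sigma_cont sigma_le] := sigma_Sigma.
have cw' : {within `[s, t0], continuous w} by exact: continuous_subspaceT.
have [t] := EVT_min st0 cw'; rewrite in_itv /= => /andP[st tt0] Hmin.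
have wmin x : s <= x -> x <= t0 -> w t <= w x.
  by move=> sx xt0; apply: Hmin; rewrite in_itv /= sx.
have [tau [stau taut stau' Htau]] := last_point_le sigma_cont st (sigma_le s).
have wt0 : 0 <= w t by exact: clampB_ge0.
have wtau : w tau = w t.
  apply/eqP; rewrite eq_le; apply/andP; split; last exact: wmin (le_trans taut tt0).
  have := @left_gronwall tau t (w t) (le_trans as_ stau) taut tt0.
  rewrite subrr mul0r subr_le0; apply.
    by move=> x tx xt; apply: wmin; [exact: le_trans tx|exact: le_trans tt0].
  move=> x y tx xy yt; rewrite -intaZ; last exact: Lloc_p.
  apply: le_inta_ae; [by apply: LlocZ; exact: Lloc_p|exact: Lloc_l0w|].
  (* [w >= w t] is known only on [[s, t0]], while positivity requires it on the whole line. [w']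
     satisfies it there and agrees with [w] on [[sigma z, z]], which is enough for [l0]. *)
  pose w' x := Num.max (w x) (w t).
  have cw'' : continuous w' by apply: continuous_max2 => //; exact: cst_continuous.
  have H1 : \forall z \ae mu, w t * l0 (cst 1) z <= l0 w' z.
    have := positive_operator_le l0_lin l0_pos (@cst_continuous _ _ (w t)) cw''.
    move=> H; apply: (aeS2 _ (H _) (linear_operator_cst (w t) l0_lin)).
      by move=> z h <-.
    by move=> z /=; rewrite /w' le_max lexx orbT.
  have [_ H2] := l0_Vsigma.
  have H3 := aeS2 (fun z => @conj _ _) (H2 w w' cw cw'') p_le.
  (* The point [tau] is discarded because [sigma z > s] is known only for [z > tau]. *)
  apply: (aeS3 _ (ae_neq tau) H1 H3) => z zt h1 [h2 h3] xz zy.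
  have zt0 : z <= t0 by apply: le_trans zy (le_trans yt tt0).
  have tz : tau < z by rewrite lt_neqAle eq_sym zt (le_trans tx).
  rewrite h2//.
    by apply: le_trans h1; rewrite ler_wpM2l// h3.
  move=> q sq qz; rewrite /w' max_l//; apply: wmin.
    by apply: le_trans sq; apply/ltW/Htau => //; exact: le_trans zy yt.
  exact: le_trans qz zt0.
have := @left_gronwall s tau 0 as_ stau (le_trans taut tt0).
rewrite !subr0 => H; apply: le_trans (H _ _) _.
- by move=> x _ _; exact: clampB_ge0.
- by move=> x y _ _ _; rewrite mul0r inta_l0w_ge0.
rewrite wtau; apply: ler_pM; [exact: wt0|exact: expR_ge0|exact: wmin|].
rewrite ler_expR; apply: le_trans (p_M (le_trans taut tt0)).
apply: inta_subitv => //; first exact: Lloc_p.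
by apply: aeS p_ge0.
Qed.

End left_estimates.

Section left_existence.
Context {R : realType}.
Notation mu := (@lebesgue_measure R).
Context (l0 l1 f : (R -> R) -> R -> R).
Hypotheses (l0_lin : linear_operator l0) (l0_pos : positive_operator l0)
  (l1_lin : linear_operator l1) (l1_pos : positive_operator l1)
  (f_car : local_caratheodory f) (l0_V : V l0) (l1_V : V l1) (f_V : V f).
Context (t0 kappa : R) (sigma : R -> R).
Hypotheses (sigma_Sigma : Sigma sigma) (l0_Vsigma : V_sigma t0 sigma l0).
Hypothesis f_zero : \forall t \ae mu, t <= t0 -> f (cst 0) t = 0.
Hypothesis (kappa_gt0 : 0 < kappa).
Hypothesis f_ge0 : forall v : R -> R, C0 `[0, kappa] v ->
     \forall t \ae mu, t <= t0 -> 0 <= f v t.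
Context (gam : R -> R) (M : R).
Hypotheses (gam_cont : continuous gam) (gam_gt0 : forall t, 0 < gam t).
Hypothesis gam_le : forall x y, x <= y -> y <= t0 ->
  gam y - gam x <= - inta (l1 gam) x y.
Hypothesis p_le : \forall t \ae mu, t <= t0 -> l1 gam t / gam t <= l0 (cst 1) t.
Hypothesis p_M : forall t, t <= t0 -> inta (fun s => l1 gam s / gam s) (sigma t) t <= M.
Context (c : R).
Hypotheses (c_gt0 : 0 < c) (c_le : c <= kappa * expR (- M)).

(* Any level above [kappa] would do: it makes the truncation of [l0] and [l1]
   inactive once the truncated function is bounded by [kappa]. *)
Let B := 2 * kappa.
Let B_gt0 : 0 < B. Proof. by rewrite mulr_gt0. Qed.
Let kB : kappa < B. Proof. by rewrite /B mulr_natl mulr2n ltrDl. Qed.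
Notation F := (truncated l0 l1 f (cst 0) (cst B) (cst 0) (cst kappa)).
Notation left_solution := (left_solution l0 l1 f t0 kappa B).

Let FC : causal_operator F.
Proof. exact: left_causal. Qed.

Let upper a u (a_t0 : a <= t0) (Lu : left_solution a u) :=
  left_upper l0_lin l0_pos l1_lin l1_pos f_car l0_V l1_V f_V sigma_Sigma l0_Vsigma
    kappa_gt0 B_gt0 f_ge0 gam_cont gam_gt0 gam_le p_le p_M a_t0 Lu.

Let ratio a u (a_t0 : a <= t0) (Lu : left_solution a u) :=
  left_ratio l0_lin l0_pos l1_lin l1_pos f_car l0_V l1_V f_V
    kappa_gt0 B_gt0 f_ge0 gam_cont gam_gt0 gam_le a_t0 Lu.

Lemma truncated_zero : \forall t \ae mu, t <= t0 -> F (cst 0) t = 0.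
Proof.
have E b : 0 <= b -> clamp (cst 0) (cst b) (cst 0) = cst 0 :> (R -> R).
  by move=> b0; apply/funext => t; rewrite clamp_id.
rewrite /truncated !E ?ltW//.
apply: (aeS3 _ f_zero (linear_operator_cst 0 l0_lin) (linear_operator_cst 0 l1_lin)).
by move=> t H -> -> /H ->; rewrite !mul0r subr0 addr0.
Qed.

Lemma left_solution_of_integral a u l : continuous u -> 0 <= l ->
  (forall t, u t = l + inta (F u) a (Num.max t a)) -> left_solution a u.
Proof.
move=> cu l0' uE; split => //.
- move=> x y ax xy yt0; rewrite !uE opprD addrACA subrr add0r inta_max_sub//.
    by rewrite !max_l// (le_trans ax).
  exact: causal_Lloc.
- by move=> t ta; rewrite !uE !max_r// !inta_xx.
- by rewrite uE max_r// inta_xx addr0.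
Qed.

Section shooting.
Context (a : R) (a_t0 : a <= t0) (U : set_system nat) {UU : UltraFilter U}.
Hypothesis oo_U : \oo `<=` U.
Let PU : ProperFilter U := ultra_proper.
Existing Instance PU.

Notation ton := (tonelli_seq F a (fun=> 0)).

(** [lam] varies with [n] because the constant found by the intermediate value theorem depends on
    the approximation. *)
Lemma left_tonelli_limit (lam : nat -> R) : (forall n, 0 <= lam n <= kappa) ->
  exists u, [/\ left_solution a u, lam n @[n --> U] --> u a &
    ton (lam n) n t0 @[n --> U] --> u t0].
Proof.
move=> lamk.
have c0 : continuous ((fun=> 0) : R -> R) by exact: cst_continuous.
have lamM n : `|lam n| <= kappa.
  by have /andP[h1 h2] := lamk n; rewrite ger0_norm.
have [u [l [cu laml unu uE]]] := @tonelli_limit R F FC a _ c0 U UU oo_U lam kappa lamM.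
have l_ge0 : 0 <= l.
  by apply: (cvgr_to_ge laml); apply: filterE => n; have /andP[] := lamk n.
exists u; split.
- by apply: (@left_solution_of_integral a u l) => // t; rewrite uE addr0.
- by rewrite uE max_r// inta_xx !addr0.
- exact: locally_uniform_cvg unu.
Qed.

Lemma ton_continuous n : continuous (fun lam => ton lam n t0).
Proof.
move=> lam; apply/continuous_epsP => e e0.
have c0 : continuous ((fun=> 0) : R -> R) by exact: cst_continuous.
have [r r0 H] := @tonelli_param_continuous R F FC a _ c0 n.+1%:R^-1 (n.+1 ^ 2).+1 `|t0| e lam e0.
exists r => // s sr; apply: H => //; last exact: ler_norm.
by rewrite lerNl -normrN ler_norm.
Qed.

(** Starting from the constant [kappa], the upper estimate forces the limit to be at least
    [kappa * expR (- M) >= c] at [t0]; starting from 0, the approximations stay 0. The value [c]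
    lies between. *)
Lemma left_shooting : exists u, [/\ left_solution a u, u t0 = c &
  forall t, t <= t0 -> u t <= kappa].
Proof.
have [|uk [Luk uka ukt0]] := @left_tonelli_limit (fun=> kappa).
  by move=> n; rewrite lexx ltW.
have cM : c * expR M <= kappa.
  apply: le_trans (_ : kappa * expR (- M) * expR M <= _).
    by rewrite ler_wpM2r// expR_ge0.
  by rewrite -mulrA -expRD addNr expR0 mulr1.
have {}uka : uk a = kappa by apply: cvg_unique uka _ => //; exact: cvg_cst.
have kc : c <= uk t0.
  have := upper a_t0 Luk a_t0.
  rewrite clamp_id /= ?uka; [|exact: ltW|exact: ltW].
  have [ukt _] := ratio a_t0 Luk (lexx t0).
  have wu : clamp (cst 0) (cst B) uk t0 <= uk t0.
    by rewrite /clamp /= ge_max ukt ge_min lexx.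
  move=> kw; apply: le_trans c_le _; rewrite expRN ler_pdivrMr ?expR_gt0//.
  by apply: le_trans kw _; rewrite ler_wpM2r// expR_ge0.
(* At a fixed index the approximation from [kappa] may still end below [c], so the target is the
   smaller of the two values; it tends to [c]. A negative end value occurs only for indices that the
   limit ignores, and there 0 is a harmless choice. *)
have /choice[lam lamP] n : exists l, 0 <= l <= kappa /\
    (0 <= ton kappa n t0 -> ton l n t0 = Num.min c (ton kappa n t0)).
  have [tk|tk] := leP 0 (ton kappa n t0); last by exists 0; rewrite lexx ltW.
  have ton0 : ton 0 n t0 = 0.
    apply: (@tonelli_zero R F FC a _ (@cst_continuous _ _ 0) _ _ t0) => //.
    exact: truncated_zero.
  have cw : {within `[0, kappa], continuous (fun lam => ton lam n t0)}.
    by apply: continuous_subspaceT; exact: ton_continuous.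
  have [|l] := IVT (ltW kappa_gt0) cw (v := Num.min c (ton kappa n t0)).
    rewrite ton0 min_l// max_r// le_min ltW//= tk /=.
    by rewrite ge_min lexx orbT.
  by rewrite in_itv /= => lk lE; exists l; split.
have [|u [Lu _ ut0]] := @left_tonelli_limit lam.
  by move=> n; have [] := lamP n.
have utc : u t0 = c.
  have L : Num.min c (ton kappa n t0) @[n --> U] --> Num.min c (uk t0).
    have cm : {for uk t0, continuous (fun x : R => Num.min c x)}.
      exact: (@continuous_min2 R (cst c) id (@cst_continuous _ _ c) (fun x => cvg_id)).
    exact: (continuous_cvg _ cm ukt0).
  rewrite min_l// in L; apply: cvg_unique ut0 _ => //.
  apply: cvg_trans L; apply: near_eq_cvg.
  have /cvgrPdist_lt/(_ _ (lt_le_trans c_gt0 kc)) := ukt0.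
  apply: filterS => n; rewrite ltr_norml => /andP[_ h].
  by have [_ ->//] := lamP n; lra.
exists u; split=> // t tt0.
have := upper a_t0 Lu tt0.
have wc : clamp (cst 0) (cst B) u t0 <= c.
  by rewrite /clamp /= utc ge_max ltW//= ge_min lexx.
move=> h; have {h} : clamp (cst 0) (cst B) u t <= kappa.
  by apply: le_trans h (le_trans _ cM); rewrite ler_wpM2r// expR_ge0.
rewrite /clamp /= ge_max ge_min => /andP[_ /orP[//|]].
by move=> Bk; have := lt_le_trans kB Bk; rewrite ltxx.
Qed.

End shooting.

Lemma inta_min_le (G : R -> R) x y : Lloc_nonneg G -> x <= y ->
  inta G (Num.min x t0) (Num.min y t0) <= inta G x y.
Proof.
move=> [lG G0] xy; have [yt|ty] := leP y t0; have [xt|tx] := leP x t0 => //.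
- by move: (lt_le_trans tx (le_trans xy yt)); rewrite ltxx.
- by apply: inta_subitv => //; [exact: ltW|apply: aeT].
- by rewrite inta_xx inta_ge0.
Qed.

Lemma left_global : exists v : R -> R, [/\ continuous v, forall t, 0 <= v t <= kappa, v t0 = c,
  forall x y, x <= y -> y <= t0 ->
    v y - v x = inta (fun t => l0 v t - l1 v t + f v t) x y &
  forall s t, s <= t -> t <= t0 -> v s * gam t <= v t * gam s].
Proof.
have [U [UU oo_U]] := ultraFilterLemma (F := \oo) _.
have PU : ProperFilter U by exact: ultra_proper.
have an_t0 n : t0 - n%:R <= t0 by rewrite lerBlDr lerDl.
have /choice[un unP] n : exists u, [/\ left_solution (t0 - n%:R) u, u t0 = c &
    forall t, t <= t0 -> u t <= kappa].
  exact: (@left_shooting _ (an_t0 n) U UU oo_U).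
(* Nothing is known of [un n] after [t0]; freezing it there gives bounds on the whole line. *)
pose vn n := theta t0 (un n).
have cvn n : continuous (vn n).
  by apply: continuous_theta; have [[]] := unP n.
have un_ge0 n t : t <= t0 -> 0 <= un n t.
  by move=> tt0; have [Lu _ _] := unP n; have [] := ratio (an_t0 n) Lu tt0.
have vn01 n t : 0 <= vn n t <= kappa.
  have mt : Num.min t t0 <= t0 by rewrite ge_min lexx orbT.
  by rewrite un_ge0//=; have [_ _] := unP n; exact.
have [G LG GB] := causal_bound FC t0.
have unE n x y : x <= y -> y <= t0 ->
    un n y - un n x = inta (F (un n)) (Num.max x (t0 - n%:R)) (Num.max y (t0 - n%:R)).
  move=> xy yt0; have [Lu _ _] := unP n.
  have uE z : un n (Num.max z (t0 - n%:R)) = un n z.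
    by have [za|//] := leP z (t0 - n%:R); rewrite (left_const Lu za).
  rewrite -(uE y) -(uE x); apply: (left_eq Lu).
  - by rewrite le_max lexx orbT.
  - by rewrite ge_max !le_max xy lexx orbT.
  - by rewrite ge_max yt0 an_t0.
have vn_incr n x y : x <= y -> `|vn n y - vn n x| <= inta G x y.
  move=> xy; apply: le_trans (inta_min_le LG xy).
  have mxy : Num.min x t0 <= Num.min y t0.
    by rewrite le_min !ge_min xy lexx orbT.
  apply: le_trans (inta_max_le (t0 - n%:R) LG mxy).
  have [Lu _ _] := unP n; have cu := left_cont Lu.
  have my : Num.min y t0 <= t0 by rewrite ge_min lexx orbT.
  rewrite /vn /theta unE//; apply: inta_le_norm; [exact: causal_Lloc|by case: LG|].
  apply: aeS (GB _ cu) => t H _ ty; apply: H; apply: le_trans ty _.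
  by rewrite ge_max my an_t0.
have [||v cv vnv] := @equicontinuous_ultra_limit R U UU vn.
- move=> t; exists kappa => n; have /andP[h1 h2] := vn01 n t.
  by rewrite ger0_norm.
- move=> t e e0; have [d d0 H] := inta_small t LG.1 e0.
  have GE x y : inta (fun s => `|G s|) x y = inta G x y.
    by apply: eq_inta => r _ _; rewrite ger0_norm//; case: LG.
  exists d => // n s; rewrite ltr_norml => /andP[s1 s2].
  have [st|/ltW ts] := leP s t.
    by rewrite distrC; apply: le_lt_trans (vn_incr n _ _ st) _; rewrite -GE; apply: H; lra.
  by apply: le_lt_trans (vn_incr n _ _ ts) _; rewrite -GE; apply: H; lra.
have lim t : vn n t @[n --> U] --> v t by exact: locally_uniform_cvg vnv.
have v01 t : 0 <= v t <= kappa.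
  apply/andP; split.
    by apply: (cvgr_to_ge (lim t)); apply: filterE => n; have /andP[] := vn01 n t.
  by apply: (cvgr_to_le (lim t)); apply: filterE => n; have /andP[] := vn01 n t.
exists v; split => //.
- have E : (fun n => vn n t0) = cst c.
    by apply/funext => n; rewrite /vn theta_le//; have [] := unP n.
  by have := lim t0; rewrite E => L; apply: cvg_unique L _ => //; exact: cvg_cst.
- move=> x y xy yt0.
  have Fv : F v = (fun t => l0 v t - l1 v t + f v t).
    have E b : kappa <= b -> clamp (cst 0) (cst b) v = v.
      move=> kb; apply/funext => t; have /andP[h1 h2] := v01 t.
      by apply: clamp_id => //=; exact: le_trans h2 kb.
    by rewrite /truncated !E// ltW.
  rewrite -Fv.
  have L1 : vn n y - vn n x @[n --> U] --> v y - v x by apply: cvgB; exact: lim.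
  have L2 : inta (F (vn n)) x y @[n --> U] --> inta (F v) x y.
    exact: causal_inta_cvg.
  have nx : \forall n \near U, t0 - x <= n%:R by apply: oo_U; exact: nbhs_infty_ger.
  have E : {near U, (fun n => inta (F (vn n)) x y) =1 (fun n => vn n y - vn n x)}.
    apply: filterS nx => n nx; have [Lu _ _] := unP n; have cu := left_cont Lu.
    rewrite /vn !theta_le//; last exact: le_trans xy yt0.
    rewrite (left_eq Lu) //; last by rewrite lerBlDr -lerBlDl.
    by apply: causal_inta_eq => //; [exact: cvn|move=> s sy]; rewrite theta_le// (le_trans sy yt0).
  have L3 : vn n y - vn n x @[n --> U] --> inta (F v) x y.
    by apply: cvg_trans L2; exact: near_eq_cvg E.
  exact: (cvg_unique (@Rhausdorff R) L1 L3).
- move=> s t st tt0.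
  have L1 : vn n s * gam t @[n --> U] --> v s * gam t.
    by apply: cvgM; [exact: lim|exact: cvg_cst].
  have L2 : vn n t * gam s @[n --> U] --> v t * gam s.
    by apply: cvgM; [exact: lim|exact: cvg_cst].
  apply: (ler_cvg_to L1 L2); apply: filterE => n.
  have [Lu _ uk] := unP n; have [ut0 /(_ s st)] := ratio (an_t0 n) Lu tt0.
  have st0 := le_trans st tt0.
  have us0 := un_ge0 n s st0.
  have usB : un n s <= B by exact: le_trans (uk s st0) (ltW kB).
  have utB : un n t <= B by exact: le_trans (uk t tt0) (ltW kB).
  by rewrite /vn !theta_le// !clamp_id.
Qed.

End left_existence.

(** * Positivity *)

Section osgood.
Context {R : realType}.
Notation mu := (@lebesgue_measure R).
Notation Lloc := (@locally_integrable R [set: R]).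
Context (l0 l1 f : (R -> R) -> R -> R).
Hypotheses (l0_lin : linear_operator l0) (l0_pos : positive_operator l0)
  (l1_pos : positive_operator l1) (l0_V : V l0) (l1_V : V l1) (f_V : V f).
Context (t0 kappa : R) (g h0 : R -> R).
Hypotheses (kappa_gt0 : 0 < kappa) (g_Lloc : Lloc_nonneg g)
  (h0_gt0 : forall x, 0 < x -> 0 < h0 x)
  (h0_cont : {within `]0, +oo[, continuous h0})
  (h0_nondecreasing : forall x y : R, 0 < x -> x <= y -> h0 x <= h0 y)
  (f_le_g : forall v : R -> R, C0 `[0, kappa] v -> (exists t, v t != 0) ->
     \forall t \ae mu, t <= t0 -> f v t <= g t * h0 (supnorm v))
  (h0_osgood :
     (\int[mu]_(s in `[x, 1%R]) ((h0 s)^-1)%:E)%E @[x --> (0 : R)^'+] --> +oo%E).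
Context (gam : R -> R) (c : R) (v : R -> R).
Hypotheses (gam_gt0 : forall t, 0 < gam t) (c_gt0 : 0 < c).
Hypotheses (v_cont : continuous v) (v01 : forall t, 0 <= v t <= kappa) (v_t0 : v t0 = c)
  (v_eq : forall x y, x <= y -> y <= t0 ->
    v y - v x = inta (fun t => l0 v t - l1 v t + f v t) x y)
  (v_ratio : forall s t, s <= t -> t <= t0 -> v s * gam t <= v t * gam s).

Let A := l0 (cst 1).
Let c1 : continuous (cst 1 : R -> R). Proof. exact: cst_continuous. Qed.
Let LA : Lloc A. Proof. exact: V_Lloc. Qed.
Let A0 : \forall t \ae mu, 0 <= A t.
Proof. by apply: l0_pos => // t; exact: ler01. Qed.

(** Frozen at [y], where the bound [m] is attained, [v] has norm exactly [m], so the growth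
    condition on [f] yields [h0 m]. The term with [l1] has a favourable sign and is dropped. *)
Lemma osgood_step x y m : x <= y -> y <= t0 -> 0 < m -> v y = m ->
  (forall s, s <= y -> v s <= m) ->
  v y - v x <= m * inta A x y + h0 m * inta g x y.
Proof.
move=> xy yt0 m0 vym vm.
have [Lg g0] := g_Lloc.
have cw : continuous (theta y v) by exact: continuous_theta.
have wm t : `|theta y v t| <= m.
  have /andP[h _] := v01 (Num.min t y).
  by rewrite /theta ger0_norm// vm// ge_min lexx orbT.
have snm : supnorm (theta y v) = m.
  apply/eqP; rewrite eq_le supnorm_le//=.
  have := le_supnorm y wm; rewrite /theta minxx vym.
  by apply: le_trans; exact: ler_norm.
have E s : s <= y -> v s = theta y v s by move=> sy; rewrite theta_le.
have H1 := V_eq l0_V v_cont cw E.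
have H2 : \forall t \ae mu, l0 (theta y v) t <= m * A t.
  have := positive_operator_le l0_lin l0_pos cw (@cst_continuous _ _ m).
  move=> H; apply: (aeS2 _ (H _) (linear_operator_cst m l0_lin)).
    by move=> t h1 <-.
  by move=> t; apply: le_trans (wm t); exact: ler_norm.
have H3 : \forall t \ae mu, 0 <= l1 v t.
  by apply: l1_pos => // t; have /andP[] := v01 t.
have H4 := V_eq f_V v_cont cw E.
have H5 : \forall t \ae mu, t <= t0 -> f (theta y v) t <= g t * h0 m.
  rewrite -snm; apply: f_le_g; last first.
    by exists y; rewrite /theta minxx vym gt_eqF.
  apply: bounded_C0 wm _ => // t.
  by rewrite /= in_itv /=; exact: v01.
rewrite v_eq// -intaZ// -intaZ// -intaD; [|exact: LlocZ|exact: LlocZ].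
apply: le_inta_ae.
- by apply: LlocD; [apply: LlocB|]; exact: V_Lloc.
- by apply: LlocD; exact: LlocZ.
apply: (aeS3 _ (aeS2 (fun t => @conj _ _) H1 H2) H3 (aeS2 (fun t => @conj _ _) H4 H5)).
move=> t [h1 h2] h3 [h4 h5] xt ty.
rewrite h1// h4//; have := h5 (le_trans ty yt0); lra.
Qed.

(** Agrees with [1 / h0] on [[eta, +oo[] and is continuous on the whole line, hence locally
    integrable. *)
Definition inv_h0 (eta : R) (s : R) := (h0 (Num.max s eta))^-1.

Lemma continuous_inv_h0 eta : 0 < eta -> continuous (inv_h0 eta).
Proof.
move=> eta0 t.
have m0 s : 0 < Num.max s eta by rewrite lt_max eta0 orbT.
apply: cvgV; first by rewrite gt_eqF// h0_gt0.
have ch : {for Num.max t eta, continuous h0}.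
  move: h0_cont; rewrite continuous_open_subspace; last exact: interval_open.
  by apply; rewrite inE /= in_itv /= andbT.
apply: (@continuous_comp _ _ _ (fun s => Num.max s eta) h0 _ _ ch).
by apply: continuous_max; [exact: cvg_id|exact: cvg_cst].
Qed.

Lemma inta_inv_h0_le eta x y : 0 < eta -> eta <= x -> x <= y ->
  inta (inv_h0 eta) x y <= (y - x) / h0 x.
Proof.
move=> eta0 ex xy; rewrite mulrC -inta_cst//.
apply: le_inta_ae.
- by apply: continuous_Lloc; exact: continuous_inv_h0.
- by apply: continuous_Lloc; exact: cst_continuous.
apply: aeT => s xs sy; have x0 : 0 < x by exact: lt_le_trans ex.
rewrite /inv_h0 max_l ?(le_trans ex)// lef_pV2 ?posrE ?h0_gt0//.
  exact: h0_nondecreasing.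
exact: lt_le_trans xs.
Qed.

(* While [v] grows from [b / 2] to [b], the term with [l0] contributes at most
   [b / 4], hence [b / h0 b] is at most 4 times the integral of [g] over that
   time; summing over the levels [b / 2 ^+ k] bounds the integral of [1 / h0]. *)
Lemma osgood_bound z e eta : 0 < eta -> z <= e -> e <= t0 ->
  inta A z e <= 4^-1 -> (forall s, s <= z -> v s = 0) ->
  forall N y b, z <= y -> y <= e -> v y = b -> eta <= b / 2 ^+ N ->
    (forall s, s <= y -> v s <= b) ->
    inta (inv_h0 eta) (b / 2 ^+ N) (2 * b) <= 4 * inta g z y.
Proof.
move=> eta0 ze et0 Aze vz.
have [Lg g0] := g_Lloc.
have LH : Lloc (inv_h0 eta) by apply: continuous_Lloc; exact: continuous_inv_h0.
have step y b : z <= y -> y <= e -> v y = b -> eta <= b -> (forall s, s <= y -> v s <= b) ->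
    exists x, [/\ z <= x, x <= y, v x = b / 2, (forall s, s <= x -> v s <= b / 2) &
      inta (inv_h0 eta) b (2 * b) <= 4 * inta g x y].
  move=> zy ye vyb eb vb.
  have b0 : 0 < b by exact: lt_le_trans eb.
  have vzb : v z <= b / 2 by rewrite vz//; lra.
  have vyb2 : b / 2 <= v y by lra.
  have [x [zx xy vx Hx]] := first_point_eq v_cont zy vzb vyb2.
  have yt0 := le_trans ye et0.
  exists x; split=> //.
    move=> s sx; have [zs|sz] := leP z s; first exact: Hx.
    by rewrite vz ?(ltW sz)//; lra.
  have := osgood_step xy yt0 b0 vyb vb; rewrite vyb vx => H.
  have Axy : inta A x y <= 4^-1.
    by apply: le_trans Aze; apply: inta_subitv => //; apply: aeS A0.
  have h : 0 < h0 b by exact: h0_gt0.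
  have Hb : b <= 4 * (h0 b * inta g x y).
    have := ler_wpM2l (ltW b0) Axy; lra.
  (* As [h0] is nondecreasing, the integral of [1 / h0] over [[b, 2 * b]] is at most [b / h0 b]: the
     rise from [b / 2] to [b] pays for the dyadic interval above it, whence the upper limit [2 * b]
     in the statement. *)
  apply: le_trans (inta_inv_h0_le eta0 eb _) _; first lra.
  by rewrite ler_pdivrMr//; lra.
elim=> [|N IH] y b zy ye vyb eb vb.
  rewrite expr0 divr1 in eb *.
  have [x [zx xy _ _ H]] := step y b zy ye vyb eb vb.
  apply: le_trans H _; rewrite ler_wpM2l//.
  by apply: inta_subitv => //; apply: aeT.
have b0 : 0 < b.
  by have := lt_le_trans eta0 eb; rewrite pmulr_lgt0 ?invr_gt0 ?exprn_gt0.
have N1 : b / 2 ^+ N.+1 <= b.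
  rewrite ler_pdivrMr ?exprn_gt0// ler_peMr ?(ltW b0)//.
  by apply: exprn_ege1; lra.
have [x [zx xy vx Hx H]] := step y b zy ye vyb (le_trans eb N1) vb.
have bN : b / 2 ^+ N.+1 = b / 2 / 2 ^+ N by rewrite exprS invfM mulrA.
have := IH x (b / 2) zx (le_trans xy ye) vx; rewrite -bN => /(_ eb Hx).
rewrite [2 * (b / 2)]mulrC divfK ?pnatr_eq0// => IH'.
rewrite (inta_chasles (y := b) LH N1); last lra.
by rewrite (inta_chasles Lg zx xy); lra.
Qed.

Lemma osgood_positive t : t <= t0 -> 0 < v t.
Proof.
move=> tt0; have /andP[vt0 _] := v01 t; rewrite lt_neqAle vt0 andbT.
apply/negP => /eqP/esym vt.
have vt' : v t <= 0 by rewrite vt.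
have [z [tz zt0 vz0 Hz]] := last_point_le v_cont tt0 vt'.
have vz s : s <= z -> v s = 0.
  move=> sz; apply/eqP; rewrite eq_le; have /andP[-> _] := v01 s; rewrite andbT.
  have := v_ratio sz zt0.
  rewrite (_ : v z = 0); last by apply/eqP; rewrite eq_le vz0; have /andP[->] := v01 z.
  by rewrite mul0r pmulr_lle0.
have zt : z < t0.
  rewrite lt_neqAle zt0 andbT; apply/negP => /eqP zE.
  by move: c_gt0; rewrite -v_t0 -zE vz// ltxx.
have [Lg g0] := g_Lloc.
have p40 : 0 < 4^-1 :> R by [].
have [d d0 Hd] := inta_small z LA p40.
pose e := Num.min t0 (z + d / 2).
have ze : z < e by rewrite lt_min zt /=; lra.
have et0 : e <= t0 by rewrite ge_min lexx.
have ed : e <= z + d / 2 by rewrite ge_min lexx orbT.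
have Aze : inta A z e <= 4^-1.
  apply: le_trans (ler_norm _) _; apply: le_trans (inta_norm _ _ LA) _.
  by apply/ltW/Hd; lra.
have cv' : {within `[z, e], continuous v} by exact: continuous_subspaceT.
(* A maximum point is needed because the dyadic estimate requires [v <= v y] on the whole past of
   [y]. *)
have [y] := EVT_max (ltW ze) cv'; rewrite in_itv /= => /andP[zy ye] Hmax.
pose b := v y.
have b0 : 0 < b.
  apply: lt_le_trans (Hz e ze et0) _; apply: Hmax.
  by rewrite in_itv /= lexx ltW.
have vb s : s <= y -> v s <= b.
  move=> sy; have [zs|sz] := leP z s; last by rewrite vz ltW.
  by apply: Hmax; rewrite in_itv /= zs (le_trans sy).
(* Bounds the integral of [1 / h0] over [[x, 1]] for every small [x]: the first term serves up to
   [2 * b], the second from there to 1, an interval of length below 1 if there is one. *)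
pose K := 4 * inta g z y + (h0 (2 * b))^-1.
have /cvgeyPge/(_ (K + 1)) := h0_osgood.
rewrite /at_right => /nbhs_ballP[r /= r0 Hr].
pose r' := Num.min r 1.
have r'0 : 0 < r' by rewrite lt_min r0 ltr01.
have [N bN] : exists N : nat, b / 2 ^+ N < r'.
  exists (Num.bound (b / r')).
  have := archi_boundP (ltW (divr_gt0 b0 r'0)).
  set n := Num.bound _ => h.
  rewrite ltr_pdivrMr ?exprn_gt0// mulrC -ltr_pdivrMr//.
  apply: lt_le_trans h _; rewrite -natrX ler_nat.
  exact/ltnW/ltn_expl.
pose x := b / 2 ^+ N.
have x0 : 0 < x by rewrite divr_gt0// exprn_gt0.
have xr : x < r by apply: lt_le_trans bN _; rewrite ge_min lexx.
have x1 : x < 1 by apply: lt_le_trans bN _; rewrite ge_min lexx orbT.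
have := Hr x; rewrite /ball /= sub0r normrN gtr0_norm// => /(_ xr x0).
have LH : Lloc (inv_h0 x) by apply: continuous_Lloc; exact: continuous_inv_h0.
have H0 s : 0 <= inv_h0 x s.
  by rewrite /inv_h0 invr_ge0 ltW// h0_gt0// lt_max x0 orbT.
have xb : x <= 2 * b.
  apply: le_trans (_ : b <= _); last lra.
  rewrite /x ler_pdivrMr ?exprn_gt0// ler_peMr ?(ltW b0)//.
  by apply: exprn_ege1; lra.
have -> : (\int[mu]_(s in `[x, 1%R]) ((h0 s)^-1)%:E)%E = (inta (inv_h0 x) x 1)%:E.
  rewrite /inta /Rintegral fineK; last exact: integrable_fin_num (Lloc_integrable x 1 LH).
  apply: eq_integral => s; rewrite inE /= in_itv /= => /andP[xs _].
  by rewrite /inv_h0 max_l.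
rewrite lee_fin.
have B1 := osgood_bound x0 (ltW ze) et0 Aze vz zy ye erefl (lexx x) vb.
have b20 : 0 < 2 * b by lra.
have hb := h0_gt0 b20.
have : inta (inv_h0 x) x 1 <= K.
  have [b1|b1] := leP 1 (2 * b).
    apply: le_trans (_ : inta (inv_h0 x) x (2 * b) <= _).
      by apply: inta_subitv => //; [exact: ltW|apply: aeT].
    by apply: le_trans B1 _; rewrite /K lerDl invr_ge0 ltW.
  rewrite (inta_chasles LH xb (ltW b1)) /K; apply: lerD => //.
  apply: le_trans (inta_inv_h0_le x0 xb (ltW b1)) _.
  by rewrite ler_pdivrMr// mulVf ?gt_eqF//; lra.
lra.
Qed.

End osgood.

(** * The equation to the right of t0 *)

Section continuous_majorant.
Context {R : realType}.

(** The ramp of index [i] rises from 0 to 1 on [[a + i - 1, a + i]]. Near any point only finitely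
    many ramps are nonzero, so the series is locally the finite sum [rhoN]. *)
Lemma continuous_majorant (a k : R) (b : nat -> R) : 0 <= k -> exists rho : R -> R,
  [/\ continuous rho, forall t, k <= rho t,
      forall c, exists r, forall t, t <= c -> rho t <= r &
      forall n t, a + n%:R <= t -> b n <= rho t].
Proof.
move=> k0; pose ramp (s : R) := Num.max 0 (Num.min 1 s).
have ramp0 s : 0 <= ramp s by rewrite /ramp le_max lexx.
have ramp1 s : ramp s <= 1 by rewrite /ramp ge_max ler01 ge_min lexx.
pose rhoN N (t : R) := k + \sum_(i < N) `|b i| * ramp (t - a - i%:R + 1).
have cramp : continuous ramp.
  apply: continuous_max2; first exact: cst_continuous.
  by apply: continuous_min2; [exact: cst_continuous|move=> x; exact: cvg_id].
have crhoN N : continuous (rhoN N).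
  elim: N => [|N IH].
    rewrite (_ : rhoN 0%N = cst k); first exact: cst_continuous.
    by apply/funext => t; rewrite /rhoN big_ord0 addr0.
  rewrite (_ : rhoN N.+1 = fun t => rhoN N t + `|b N| * ramp (t - a - N%:R + 1)).
    apply: continuousD2 => //; apply: continuousM2; first exact: cst_continuous.
    move=> t; apply: (@continuous_comp _ _ _ (fun s => s - a - N%:R + 1) ramp).
      apply: cvgD; last exact: cvg_cst.
      by apply: cvgB; [apply: cvgB; [exact: cvg_id|exact: cvg_cst]|exact: cvg_cst].
    exact: cramp.
  by apply/funext => t; rewrite /rhoN big_ord_recr addrA.
have stable N N' t : (N <= N')%N -> t <= a + N%:R - 1 -> rhoN N' t = rhoN N t.
  move=> NN' tN; rewrite /rhoN; congr (_ + _).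
  rewrite -(subnKC NN') big_split_ord /= [X in _ + X]big1 ?addr0// => i _.
  rewrite [ramp _]max_l ?mulr0// ge_min; apply/orP; right.
  rewrite natrD; have : 0 <= (i%:R : R) by []; lra.
pose N (t : R) := (Num.bound `|t - a|).+2.
have Nt t : t <= a + (N t)%:R - 1.
  have := archi_boundP (normr_ge0 (t - a)); have := ler_norm (t - a).
  by rewrite /N -!natr1; lra.
pose rho t := rhoN (N t) t.
have rhoE M t : t <= a + M%:R - 1 -> rho t = rhoN M t.
  move=> tM; rewrite /rho; have [NM|/ltnW MN] := leqP (N t) M.
    by rewrite -(stable _ _ _ NM).
  by rewrite (stable _ _ _ MN).
exists rho; split.
- move=> t; pose M := (N t).+1.
  apply/continuous_epsP => e e0.
  have [d d0 H] := (continuous_epsP (rhoN M) t).1 (crhoN M t) e e0.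
  exists (Num.min d 1); first by rewrite lt_min d0 ltr01.
  move=> s; rewrite lt_min => /andP[sd s1].
  have := Nt t; move: s1; rewrite ltr_norml => /andP[_ s1] tN.
  by rewrite !(rhoE M) ?H// /M -natr1; lra.
- by move=> t; rewrite /rho /rhoN lerDl sumr_ge0// => i _; rewrite mulr_ge0.
- move=> c; exists (k + \sum_(i < N c) `|b i|) => t tc.
  rewrite (rhoE (N c)); last exact: le_trans (Nt c).
  rewrite lerD2l; apply: ler_sum => i _.
  by rewrite ler_piMr.
- move=> n t nt; pose M := (maxn (N t) n.+1).
  have NM : ((N t)%:R : R) <= M%:R by rewrite ler_nat leq_maxl.
  rewrite (rhoE M); last by have := Nt t; lra.
  have nM : (n < M)%N by rewrite leq_max ltnSn orbT.
  rewrite /rhoN (bigD1 (Ordinal nM)) //= [ramp _](_ : _ = 1).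
    have := ler_norm (b n); rewrite mulr1.
    set S := \sum_(i < M | _) _; have : 0 <= S by apply: sumr_ge0 => i _; rewrite mulr_ge0.
    lra.
  by rewrite /ramp min_l ?max_r//; lra.
Qed.

End continuous_majorant.

Section lower_integral.
Context {R : realType}.
Notation mu := (@lebesgue_measure R).
Notation Lloc := (@locally_integrable R [set: R]).

(* No measurability is assumed: the integral of a nonnegative function is
   a supremum over the simple functions below it. *)
Lemma ge0_le_integral_lower (D : set R) (u v : R -> \bar R) :
  (forall t, D t -> 0 <= u t)%E -> (forall t, D t -> u t <= v t)%E ->
  (\int[mu]_(t in D) u t <= \int[mu]_(t in D) v t)%E.
Proof.
move=> u0 uv.
have v0 t : D t -> (0 <= v t)%E by move=> Dt; exact: le_trans (u0 t Dt) (uv t Dt).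
rewrite !ge0_integralE//; apply: ge_ereal_sup => _ /= [h hu <-].
apply: ereal_sup_ubound; exists h => // t; apply: le_trans (hu t) _.
by rewrite !patchE; case: ifPn => // /set_mem; exact: uv.
Qed.

Lemma Lebesgue_integrable_version (a b : R) (u : R -> R) :
  (forall t, a <= t -> 0 <= u t) -> Lebesgue_integrable `[a, b] u ->
  exists p : R -> R, [/\ Lloc p, \forall t \ae mu, a <= t -> t <= b -> u t = p t &
    ((inta p a b)%:E <= \int[mu]_(t in `[a, b]) (u t)%:E)%E].
Proof.
move=> u0 [p ip [A [mA A0 HA]]].
have mp : measurable_fun `[a, b] p by apply/measurable_EFinP; case/integrableP : ip.
have Lp : Lloc (p \_ `[a, b]) by exact: integrable_locally.
have up : \forall t \ae mu, a <= t -> t <= b -> u t = (p \_ `[a, b]) t.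
  exists A; split=> // t /= Ht; apply: HA => /= H; apply: Ht => at_ tb.
  have tab : t \in `[a, b]%classic by rewrite inE /= in_itv /= at_ tb.
  by rewrite patchE tab; apply: H; rewrite /= in_itv /= at_ tb.
exists (p \_ `[a, b]); split => //.
rewrite /inta /Rintegral fineK; last exact: integrable_fin_num (Lloc_integrable a b Lp).
pose p' t := (Num.max ((p \_ `[a, b]) t) 0 * \1_(~` A) t).
have mp' : measurable_fun setT p'.
  apply: measurable_funM; last by apply: measurable_indic; exact: measurableC.
  by apply: measurable_maxr => //; case: Lp.
rewrite (@ae_eq_integral _ _ _ mu `[a, b]%classic (fun t => (p' t)%:E)) //.
- apply: ge0_le_integral_lower => t; rewrite /= in_itv /= => /andP[at_ tb].
    by rewrite lee_fin mulr_ge0// le_max lexx orbT.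
  rewrite lee_fin /p' indicE; have [tA|tA] := pselect (A t).
    by rewrite memNset ?mulr0 ?u0// => /(_ tA).
  rewrite mem_set// mulr1 ge_max u0// andbT.
  have -> // : (p \_ `[a, b]) t = u t.
  apply/esym; have : ~~ ~~ (u t == (p \_ `[a, b]) t).
    apply/negP => /eqP h; apply: tA; apply: HA => /= H; apply: h.
    have tab : t \in `[a, b]%classic by rewrite inE /= in_itv /= at_ tb.
    by rewrite patchE tab; apply: H; rewrite /= in_itv /= at_ tb.
  by rewrite negbK => /eqP.
- by apply/measurable_EFinP; case: Lp => m _ _; exact: measurable_funTS.
- by apply/measurable_EFinP; exact: measurable_funTS.
- have nA : \forall t \ae mu, ~ A t by exists A; split => // t /=; exact: contrapT.
  move: up nA; apply: aeS2 => t h tA; rewrite /= in_itv /= => /andP[at_ tb].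
  by rewrite /p' indicE mem_set// mulr1 max_l// -h// u0.
Qed.

End lower_integral.

Section growth.
Context {R : realType}.
Notation mu := (@lebesgue_measure R).
Notation Lloc := (@locally_integrable R [set: R]).
Implicit Types (u k H : R -> R).

(** After the last point where [u] is at most the larger of [u x] and 0, [u] is positive and
    [k <= H] applies. *)
Lemma positive_growth u k H x y : continuous u -> x <= y -> Lloc k -> Lloc H ->
  (forall s t, x <= s -> s <= t -> t <= y -> u t - u s = inta k s t) ->
  (\forall t \ae mu, x <= t -> t <= y -> 0 <= H t) ->
  (\forall t \ae mu, x <= t -> t <= y -> 0 < u t -> k t <= H t) ->
  u y <= Num.max (u x) 0 + inta H x y.
Proof.
move=> cu xy lk lH uk H0 kH.
have uxm : u x <= Num.max (u x) 0 by rewrite le_max lexx.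
have [z [xz zy uz Hz]] := last_point_le cu xy uxm.
have : u y - u z <= inta H z y.
  rewrite uk//; apply: le_inta_ae => //.
  apply: (aeS2 _ kH (ae_neq z)) => t h tz zt ty.
  apply: h => //; first exact: le_trans zt.
  have zt' : z < t by rewrite lt_neqAle eq_sym tz.
  by apply: le_lt_trans (Hz t zt' ty); rewrite le_max lexx orbT.
have := inta_subitv lH xz zy (lexx y) H0; lra.
Qed.

(** The condition with [Num.sg] is one-sided for [u] and for [- u]; the growth of the positive part
    is estimated for both. *)
Lemma norm_growth u k H x y : continuous u -> x <= y -> Lloc k -> Lloc H ->
  (forall s t, x <= s -> s <= t -> t <= y -> u t - u s = inta k s t) ->
  (\forall t \ae mu, x <= t -> t <= y -> 0 <= H t) ->
  (\forall t \ae mu, x <= t -> t <= y -> k t * Num.sg (u t) <= H t) ->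
  `|u y| <= `|u x| + inta H x y.
Proof.
move=> cu xy lk lH uk H0 kH.
have Hx := ler_norm (u x); have Hx' := ler_norm (- u x); have Hn := normr_ge0 (u x).
rewrite normrN in Hx'.
have P1 : u y <= Num.max (u x) 0 + inta H x y.
  apply: (positive_growth cu xy lk lH uk H0).
  apply: aeS kH => t h xt ty ut; have := h xt ty.
  by rewrite gtr0_sg// mulr1.
have P2 : - u y <= Num.max (- u x) 0 + inta H x y.
  apply: (@positive_growth (fun t => - u t) (fun t => - k t)) => //.
  - exact: continuousN1.
  - exact: locally_integrableN.
  - move=> s t xs st ty; rewrite (@eq_inta _ _ (fun t => -1 * k t)); last first.
      by move=> r _ _; rewrite mulN1r.
    by rewrite intaZ// -uk//; ring.
  - apply: aeS kH => t h xt ty ut; have := h xt ty.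
    by rewrite ltr0_sg ?mulrN1// -oppr_gt0.
have M1 : Num.max (u x) 0 <= `|u x| by rewrite ge_max Hx.
have M2 : Num.max (- u x) 0 <= `|u x| by rewrite ge_max Hx'.
by rewrite ler_norml; apply/andP; split; lra.
Qed.

Lemma theta_bounded u a b r : continuous u -> (forall t, t <= a -> `|u t| <= r) ->
  exists r' : R, forall t, `|theta b u t| <= r'.
Proof.
move=> cu ur; have [ba|ab] := leP b a.
  by exists r => t; apply: ur; apply: le_trans ba; rewrite ge_min lexx orbT.
have cnu : {within `[a, b], continuous (fun t => `|u t|)}.
  by apply: continuous_subspaceT => t; apply: cvg_norm; exact: cu.
have [z _ Hz] := EVT_max (ltW ab) cnu.
exists (Num.max r `|u z|) => t; rewrite /theta le_max.
have [ta|at_] := leP (Num.min t b) a; first by rewrite ur.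
by rewrite Hz ?orbT// in_itv /= (ltW at_) ge_min lexx orbT.
Qed.

End growth.

Section right_estimates.
Context {R : realType}.
Notation mu := (@lebesgue_measure R).
Notation Lloc := (@locally_integrable R [set: R]).
Context (l0 l1 f : (R -> R) -> R -> R).
Hypotheses (l0_lin : linear_operator l0) (l0_pos : positive_operator l0)
  (l1_lin : linear_operator l1) (l1_pos : positive_operator l1)
  (f_car : local_caratheodory f) (l0_V : V l0) (l1_V : V l1) (f_V : V f).
Context (t0 kappa : R) (q : R -> R -> R).
Hypotheses (kappa_gt0 : 0 < kappa) (q_Kloc : Kloc t0 q)
  (q_nondecreasing : forall t x y : R, t0 <= t -> 0 <= x -> x <= y -> q t x <= q t y)
  (q_sublinear : forall b : R, t0 < b ->
     ((x^-1)%:E * \int[mu]_(s in `[t0, b]) (q s x)%:E)%E @[x --> +oo] --> 0%E)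
  (f_le_q : forall v : R -> R, C0 [set: R] v -> 0 <= v t0 <= kappa ->
     (forall t, t <= t0 -> - kappa <= v t <= kappa) ->
     \forall t \ae mu, t0 <= t -> f v t * Num.sg (v t) <= q t (supnorm v)).

Let A t := l0 (cst 1) t + l1 (cst 1) t.
Let c1 : continuous (cst 1 : R -> R). Proof. exact: cst_continuous. Qed.
Let LA : Lloc A. Proof. by apply: LlocD; exact: V_Lloc. Qed.
Let A0 : \forall t \ae mu, 0 <= A t.
Proof.
apply: (aeS2 _ (l0_pos c1 (fun=> ler01)) (l1_pos c1 (fun=> ler01))) => t.
exact: addr_ge0.
Qed.

(** An estimate [x <= K * (kappa + inta p t0 b)], with [p] a version of [q] at level [x], becomes
    impossible for [x >= B]; this is how sublinearity yields a priori bounds. *)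
Lemma sublinear_threshold b (K : R) : t0 < b -> 0 <= K -> exists2 B : R, 0 < B &
  forall x, B <= x -> exists p : R -> R, [/\ Lloc p,
    \forall t \ae mu, t0 <= t -> t <= b -> q t x = p t &
    K * (kappa + inta p t0 b) < x].
Proof.
move=> t0b K0; have [q0 _ _ qint] := q_Kloc.
have K1 : 0 < K + 1 by lra.
(* With this value [K * inta p t0 b] is at most [x / 2], and [x > 2 * (K + 1) * kappa] takes care of
   [K * kappa]. Using [K + 1] allows [K = 0]. *)
have e0 : 0 < (2 * (K + 1))^-1 by rewrite invr_gt0 mulr_gt0.
have N0 : nbhs (0%E : \bar R) [set y | (y < ((2 * (K + 1))^-1)%:E)%E].
  by apply: open_nbhs_nbhs; split; [exact: open_ereal_lt_ereal|rewrite /= lte_fin].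
have [B0 [_ HB]] := q_sublinear t0b N0.
exists (Num.max (B0 + 1) (2 * (K + 1) * kappa + 1)).
  by rewrite lt_max; apply/orP; right; have := mulr_gt0 K1 kappa_gt0; lra.
move=> x; rewrite ge_max => /andP[xB xK].
have Kk := mulr_gt0 K1 kappa_gt0.
have x0 : 0 < x by lra.
have /HB qx : B0 < x by lra.
have : Lebesgue_integrable `[t0, b] (q ^~ x).
  have := qint [set x] (@compact_set1 _ x) _ t0 b (lexx t0).
  rewrite (_ : (fun t => sup (q t @` [set x])) = (q ^~ x)); last first.
    by apply/funext => t; rewrite image_set1 sup1.
  by apply=> _ ->; rewrite /= in_itv /= ltW.
move=> /(Lebesgue_integrable_version (fun t tt => q0 t x tt (ltW x0)))[p [Lp qp pq]].
exists p; split => //.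
have : ((x^-1 * inta p t0 b)%:E < ((2 * (K + 1))^-1)%:E)%E.
  by apply: le_lt_trans qx; rewrite EFinM lee_wpmul2l// lee_fin invr_ge0 ltW.
rewrite lte_fin mulrC ltr_pdivrMr// mulrC ltr_pdivlMr ?mulr_gt0// => h.
have p0 : 0 <= inta p t0 b.
  by apply: inta_ge0_ae => //; apply: aeS qp => t e t0t tb; rewrite -e// q0// ltW.
have Kp := mulr_ge0 K0 p0.
have E1 : inta p t0 b * (2 * (K + 1)) = 2 * (K * inta p t0 b) + 2 * inta p t0 b by ring.
have E2 : 2 * (K + 1) * kappa = 2 * (K * kappa) + 2 * kappa by ring.
rewrite E1 in h; rewrite E2 in xK; rewrite mulrDr; have := kappa_gt0; lra.
Qed.

Context (rho : R -> R).
Hypotheses (rho_cont : continuous rho) (rho_ge : forall t, kappa <= rho t).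
Let Nrho t := - rho t.
Notation F := (truncated l0 l1 f Nrho rho Nrho rho).
Notation clampr := (clamp Nrho rho).
Let cNrho : continuous Nrho. Proof. exact: continuousN1. Qed.
Let rho_gt0 t : 0 < rho t. Proof. exact: lt_le_trans (rho_ge t). Qed.

Lemma clampr_norm u t : `|clampr u t| <= `|u t|.
Proof.
rewrite /clamp /Nrho; have r0 := rho_gt0 t.
have U1 := ler_norm (u t); have U2 := ler_norm (- u t); rewrite normrN in U2.
have U3 := normr_ge0 (u t).
by rewrite ler_norml; have [?|?] := leP (u t) (rho t);
  [have [?|?] := leP (- rho t) (u t)|have [?|?] := leP (- rho t) (rho t)];
  apply/andP; split; lra.
Qed.

(** Thanks to this, the sign condition on [f] at the truncated function controls the growth of [|u|]
    itself. *)
Lemma clampr_sg u t : Num.sg (clampr u t) = Num.sg (u t).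
Proof.
rewrite /clamp /Nrho; have r0 := rho_gt0 t.
have [u0|u0|u0] := ltgtP (u t) 0.
- by rewrite (ltr0_sg u0) ltr0_sg// gt_max gt_min u0 oppr_lt0 r0.
- by rewrite (gtr0_sg u0) gtr0_sg// lt_max lt_min u0 r0 orbT.
- by rewrite u0 min_l ?max_r// ?oppr_le0 ltW.
Qed.

Lemma right_causal : (forall c, exists r, forall t, t <= c -> rho t <= r) ->
  causal_operator F.
Proof.
move=> rb; have Nrr t : Nrho t <= rho t by rewrite /Nrho; have := rho_gt0 t; lra.
apply: truncated_causal => // b; have [r Hr] := rb b.
have r0 : 0 < r by apply: lt_le_trans (rho_gt0 b) (Hr b (lexx b)).
exists (r + r); first by rewrite addr_gt0.
by move=> t tb; rewrite /Nrho normrN gtr0_norm// lerD// Hr.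
Qed.

Section a_priori.
Context (FC : causal_operator F) (u : R -> R).
Hypotheses (u_cont : continuous u) (u_left : forall t, t <= t0 -> 0 <= u t <= kappa)
  (u_eq : forall x y, t0 <= x -> x <= y -> u y - u x = inta (F u) x y).

Let m y := supnorm (theta y u).

Let u_theta_bounded y : exists r, forall t, `|theta y u t| <= r.
Proof.
apply: (@theta_bounded R u t0 y kappa) => // t /u_left/andP[h1 h2].
by rewrite ger0_norm.
Qed.

Lemma le_m s y : s <= y -> `|u s| <= m y.
Proof.
move=> sy; have [r Hr] := u_theta_bounded y.
by have := le_supnorm s Hr; rewrite theta_le.
Qed.

Lemma m_le r y : (forall s, s <= y -> `|u s| <= r) -> m y <= r.
Proof. by move=> H; apply: supnorm_le => t; apply: H; rewrite ge_min lexx orbT. Qed.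

(** The nonlinear term is estimated at the single level [m b], as yet unknown, and becomes an
    additive constant; what remains is linear in [m]. The level [rho] does not enter the
    inequality. *)
Lemma right_step b p x y : Lloc p ->
  (\forall t \ae mu, t0 <= t -> t <= b -> q t (m b) = p t) ->
  t0 <= x -> x <= y -> y <= b ->
  m y <= m x + (inta A t0 y - inta A t0 x) * m y + inta p t0 b.
Proof.
move=> Lp qp t0x xy yb.
have [q0 _ _ _] := q_Kloc.
have my0 z : 0 <= m z by exact: supnorm_ge0.
have p0 : \forall t \ae mu, t0 <= t -> t <= b -> 0 <= p t.
  by apply: aeS qp => t e t0t tb; rewrite -e// q0.
have pb0 : 0 <= inta p t0 b by exact: inta_ge0_ae.
rewrite (inta_chasles LA t0x xy) [_ + inta A x y]addrC addrK.
pose w := clampr u.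
have cw : continuous w by exact: continuous_clamp.
have wm s : s <= y -> `|w s| <= m y.
  by move=> sy; apply: le_trans (clampr_norm _ _) (le_m sy).
have Tw T : linear_operator T -> positive_operator T -> V T ->
    \forall t \ae mu, t <= y -> `|T w t| <= m y * T (cst 1) t.
  move=> linT posT VT.
  have cty : continuous (theta y w) by exact: continuous_theta.
  have H1 := V_eq VT cw cty (fun s sy => esym (theta_le w sy)).
  have H2 := positive_operator_norm linT posT cty (@cst_continuous _ _ (m y)) _.
  apply: (aeS3 _ H1 (H2 _) (linear_operator_cst (m y) linT)).
    by move=> t h1 h2 h3 ty; rewrite h1// -h3.
  by move=> t; apply: wm; rewrite ge_min lexx orbT.
have fw : \forall t \ae mu, t0 <= t -> t <= b -> f w t * Num.sg (u t) <= p t.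
  have cty : continuous (theta b w) by exact: continuous_theta.
  have wb t : `|theta b w t| <= m b.
    apply: le_trans (clampr_norm _ _) _; apply: le_m; rewrite ge_min lexx orbT //.
  have t0b : t0 <= b by apply: le_trans t0x (le_trans xy yb).
  have thw s : s <= t0 -> theta b w s = u s.
    move=> st; rewrite theta_le ?(le_trans st)//; have /andP[h1 h2] := u_left st.
    rewrite /w clamp_id//; last exact: le_trans h2 (rho_ge s).
    by rewrite /Nrho; have := rho_gt0 s; lra.
  have H1 := V_eq f_V cw cty (fun s sy => esym (theta_le w sy)).
  have H2 : \forall t \ae mu, t0 <= t -> f (theta b w) t * Num.sg (theta b w t) <=
      q t (supnorm (theta b w)).
    apply: f_le_q; first exact: (bounded_C0 cty wb).
      by rewrite thw//; exact: u_left.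
    move=> t tt0; rewrite thw//; have /andP[h1 h2] := u_left tt0.
    by rewrite h2 andbT; lra.
  apply: (aeS3 _ H1 H2 qp) => t h1 h2 h3 t0t tb.
  rewrite h1// -h3//; have := h2 t0t; rewrite theta_le// clampr_sg => h.
  by apply: le_trans h (q_nondecreasing t0t (supnorm_ge0 _) (supnorm_le wb)).
pose H t := m y * A t + p t.
have LH : Lloc H by apply: LlocD => //; exact: LlocZ.
have H0 : \forall t \ae mu, t0 <= t -> t <= b -> 0 <= H t.
  apply: (aeS2 _ A0 p0) => t a0 p0' t0t tb.
  by rewrite addr_ge0// ?mulr_ge0// p0'.
have kH : \forall t \ae mu, t0 <= t -> t <= y -> F u t * Num.sg (u t) <= H t.
  apply: (aeS3 _ (Tw _ l0_lin l0_pos l0_V) (Tw _ l1_lin l1_pos l1_V) fw).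
  move=> t h0 h1 hf t0t ty; rewrite /truncated -/w mulrDl /H; apply: lerD; last first.
    exact: hf t0t (le_trans ty yb).
  apply: le_trans (ler_norm _) _; rewrite normrM.
  apply: le_trans (_ : `|l0 w t - l1 w t| * 1 <= _).
    by rewrite ler_wpM2l// normr_sg; case: (u t != 0).
  rewrite mulr1; apply: le_trans (ler_normB _ _) _.
  by rewrite /A mulrDr; apply: lerD; [exact: h0|exact: h1].
apply: m_le => s sy.
have [sx|/ltW xs] := leP s x.
  apply: le_trans (le_m sx) _; rewrite -addrA lerDl addr_ge0// mulr_ge0//.
  by apply: inta_ge0_ae => //; apply: aeS A0.
have sb := le_trans sy yb.
have : `|u s| <= `|u x| + inta H x s.
  apply: (@norm_growth R u (F u)) => //.
  - exact: (causal_Lloc FC u_cont).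
  - by move=> r t xr rt _; apply: u_eq => //; exact: le_trans xr.
  - apply: aeS H0 => t h xt ts; apply: h; first exact: le_trans xt.
    exact: le_trans ts sb.
  - apply: aeS kH => t h xt ts; apply: h; first exact: le_trans xt.
    exact: le_trans ts sy.
have Hxs : inta H x s <= inta H x y.
  apply: inta_subitv => //; apply: aeS H0 => t h xt ty; apply: h.
    exact: le_trans xt.
  exact: le_trans ty yb.
have HE : inta H x y = m y * inta A x y + inta p x y.
  by rewrite /H intaD ?intaZ//; exact: LlocZ.
have pxy : inta p x y <= inta p t0 b by exact: inta_subitv.
by have := le_m (lexx x); lra.
Qed.

End a_priori.
End right_estimates.

Section right_existence.
Context {R : realType}.
Notation mu := (@lebesgue_measure R).
Notation Lloc := (@locally_integrable R [set: R]).
Context (l0 l1 f : (R -> R) -> R -> R).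
Hypotheses (l0_lin : linear_operator l0) (l0_pos : positive_operator l0)
  (l1_lin : linear_operator l1) (l1_pos : positive_operator l1)
  (f_car : local_caratheodory f) (l0_V : V l0) (l1_V : V l1) (f_V : V f).
Context (t0 kappa : R) (q : R -> R -> R).
Hypotheses (kappa_gt0 : 0 < kappa) (q_Kloc : Kloc t0 q)
  (q_nondecreasing : forall t x y : R, t0 <= t -> 0 <= x -> x <= y -> q t x <= q t y)
  (q_sublinear : forall b : R, t0 < b ->
     ((x^-1)%:E * \int[mu]_(s in `[t0, b]) (q s x)%:E)%E @[x --> +oo] --> 0%E)
  (f_le_q : forall v : R -> R, C0 [set: R] v -> 0 <= v t0 <= kappa ->
     (forall t, t <= t0 -> - kappa <= v t <= kappa) ->
     \forall t \ae mu, t0 <= t -> f v t * Num.sg (v t) <= q t (supnorm v)).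

(** [K], [B] and then [rho] are obtained from the operators, [q] and [kappa] before any solution is
    chosen, so there is no circularity between the bound and the truncation. *)
Lemma right_global (v : R -> R) : continuous v -> (forall t, t <= t0 -> 0 <= v t <= kappa) ->
  exists u : R -> R, [/\ continuous u, forall t, t <= t0 -> u t = v t &
    forall x y, t0 <= x -> x <= y ->
      u y - u x = inta (fun t => l0 u t - l1 u t + f u t) x y].
Proof.
move=> cv v01.
have c1 : continuous (cst 1 : R -> R) by exact: cst_continuous.
pose A t := l0 (cst 1) t + l1 (cst 1) t.
have LA : Lloc A by apply: LlocD; exact: V_Lloc.
pose P y := inta A t0 (Num.max y t0).
have cP : continuous P by exact: continuous_prim.
(* The bound [B n] up to [b n] is used on [[t0 + n, t0 + n + 1]], and [rho] is above [B n] from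
   [t0 + n] on; hence [n.+1]. *)
pose b n := t0 + n.+1%:R.
have tb n : t0 < b n by rewrite ltrDl.
have /choice[K KP] n : exists K : R, 0 <= K /\ forall m (Q : R), 0 <= Q ->
    (forall x, 0 <= m x) ->
    (forall x y, t0 <= x -> x <= y -> y <= b n -> m y <= m x + (P y - P x) * m y + Q) ->
    m (b n) <= K * (m t0 + Q).
  by have [K K0 KH] := gronwall_coarse (ltW (tb n)) cP; exists K.
have /choice[B BP] n : exists B : R, forall x, B <= x -> 0 < x /\
    exists p : R -> R, [/\ Lloc p,
    \forall t \ae mu, t0 <= t -> t <= b n -> q t x = p t &
    K n * (kappa + inta p t0 (b n)) < x].
  have [B B0 HB] := sublinear_threshold kappa_gt0 q_Kloc q_sublinear (tb n) (KP n).1.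
  by exists B => x Bx; split; [exact: lt_le_trans Bx|exact: HB].
have [rho [crho rhok rhob rhoB]] := continuous_majorant t0 B (ltW kappa_gt0).
have FC := right_causal l0_lin l0_pos l1_lin l1_pos f_car l0_V l1_V f_V kappa_gt0 crho rhok rhob.
set F := truncated _ _ _ _ _ _ _ in FC.
have [U [UU oo_U]] := ultraFilterLemma (F := \oo) _.
have PU : ProperFilter U by exact: ultra_proper.
have lam0 (n : nat) : `|0 : R| <= 0 by rewrite normr0.
have [u [l [cu laml _ uE]]] := @tonelli_limit R F FC t0 v cv U UU oo_U (fun=> 0) 0 lam0.
have l0E : l = 0.
  by apply: cvg_unique laml _ => //; exact: cvg_cst.
have uv t : t <= t0 -> u t = v t.
  by move=> tt0; rewrite uE l0E max_r// inta_xx addr0 add0r min_l.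
have u01 t : t <= t0 -> 0 <= u t <= kappa by move=> tt0; rewrite uv// v01.
have u_eq x y : t0 <= x -> x <= y -> u y - u x = inta (F u) x y.
  move=> tx xy; have ty := le_trans tx xy.
  rewrite !uE !min_r// !max_l//.
  rewrite (inta_chasles (causal_Lloc FC cu) tx xy); ring.
pose m y := supnorm (theta y u).
(* Otherwise the threshold applies at the level [x = m (b n)] itself, and with [m t0 <= kappa]
   Gronwall gives [m (b n) < m (b n)]. *)
have mB n : m (b n) < B n.
  rewrite ltNge; apply/negP => /BP[m0 [p [Lp qp Kp]]].
  have p0 : 0 <= inta p t0 (b n).
    apply: inta_ge0_ae => //; apply: aeS qp => t e t0t tbn.
    by rewrite -e//; have [q0 _ _ _] := q_Kloc; rewrite q0// ltW.
  have [K0 /(_ m (inta p t0 (b n)) p0 _ _)H] := KP n.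
  have : m (b n) <= K n * (m t0 + inta p t0 (b n)).
    apply: H; first by move=> x; exact: supnorm_ge0.
    move=> x y tx xy yb; rewrite /P !max_l// ?(le_trans tx)//.
    exact: (right_step l0_lin l0_pos l1_lin l1_pos l0_V l1_V f_V kappa_gt0 q_Kloc
      q_nondecreasing f_le_q crho rhok FC cu u01 u_eq Lp qp tx xy yb).
  move=> mK; have : m (b n) < m (b n).
    apply: le_lt_trans mK (le_lt_trans _ Kp); rewrite ler_wpM2l// lerD2r.
    apply: supnorm_le => t; have /andP[h1 h2] : 0 <= theta t0 u t <= kappa.
      by apply: u01; rewrite ge_min lexx orbT.
    by rewrite ger0_norm.
  by rewrite ltxx.
have urho t : `|u t| <= rho t.
  have [tt0|tt0] := leP t t0.
    by have /andP[h1 h2] := u01 t tt0; rewrite ger0_norm//; exact: le_trans h2 (rhok t).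
  have t00 : 0 <= t - t0 by rewrite subr_ge0 ltW.
  have /andP[n1 n2] := truncn_itv t00.
  set n := Num.truncn (t - t0) in n1 n2.
  have tn : t <= b n by rewrite /b -lerBlDl ltW.
  apply: le_trans (le_m cu u01 tn) _.
  by apply: le_trans (ltW (mB n)) _; apply: rhoB; rewrite -lerBrDl.
exists u; split => // x y tx xy.
rewrite (u_eq x y tx xy) /F /truncated.
have -> // : clamp (fun t => - rho t) rho u = u.
apply/funext => t; have := urho t; rewrite ler_norml => /andP[h1 h2].
exact: clamp_id.
Qed.

End right_existence.

(** * Return to the untruncated equation and gluing at [t0] *)

Section original_equation.
Context {R : realType}.
Notation Lloc := (@locally_integrable R [set: R]).
Context (l0 l1 f : (R -> R) -> R -> R).
Hypotheses (l0_V : V l0) (l1_V : V l1) (f_V : V f).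

Lemma rhs_Lloc (u : R -> R) : continuous u -> Lloc (fun t => l0 u t - l1 u t + f u t).
Proof. by move=> cu; apply: LlocD; [apply: LlocB|]; exact: V_Lloc. Qed.

Lemma rhs_inta_eq (u v : R -> R) x y : continuous u -> continuous v ->
  (forall s, s <= y -> u s = v s) ->
  inta (fun t => l0 u t - l1 u t + f u t) x y = inta (fun t => l0 v t - l1 v t + f v t) x y.
Proof.
move=> cu cv uv; apply: eq_inta_ae; [exact: rhs_Lloc|exact: rhs_Lloc|].
apply: (aeS3 _ (V_eq l0_V cu cv uv) (V_eq l1_V cu cv uv) (V_eq f_V cu cv uv)).
by move=> t h0 h1 h2 _ ty; rewrite h0// h1// h2.
Qed.

Lemma integral_global_solution (u : R -> R) : continuous u ->
  (forall x y, x <= y -> u y - u x = inta (fun t => l0 u t - l1 u t + f u t) x y) ->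
  global_solution l0 l1 f u.
Proof.
move=> cu uE; have Lr := rhs_Lloc cu; split.
  by move=> a b ab _; apply: (AC_primitive Lr) => x y _ xy _; exact: uE.
exact: (is_derive_primitive Lr).
Qed.

End original_equation.

Theorem theorem2p3 (R : realType) (l0 l1 f : (R -> R) -> R -> R)
  (l0_cont : continuous_operator l0) (l0_lin : linear_operator l0)
  (l0_pos : positive_operator l0)
  (l1_cont : continuous_operator l1) (l1_lin : linear_operator l1)
  (l1_pos : positive_operator l1)
  (f_cont : continuous_operator f) (f_car : local_caratheodory f)
  (t0 : R) (l0_V : V l0) (l1_V : V l1) (f_V : V f)
  (sigma : R -> R) (sigma_Sigma : Sigma sigma) (l0_Vsigma : V_sigma t0 sigma l0)
  (f_zero : \forall t \ae (@lebesgue_measure R), t <= t0 -> f (cst 0) t = 0)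
  (kappa : R) (kappa_gt0 : 0 < kappa)
  (f_ge0 : forall v : R -> R, C0 `[0, kappa] v ->
     \forall t \ae (@lebesgue_measure R), t <= t0 -> 0 <= f v t)
  (q : R -> R -> R) (q_Kloc : Kloc t0 q)
  (q_nondecreasing : forall t x y : R,
     t0 <= t -> 0 <= x -> x <= y -> q t x <= q t y)
  (q_sublinear : forall b : R, t0 < b ->
     ((x^-1)%:E * \int[@lebesgue_measure R]_(s in `[t0, b]) (q s x)%:E)%E
       @[x --> +oo] --> 0%E)
  (f_le_q : forall v : R -> R, C0 [set: R] v ->
     0 <= v t0 <= kappa ->
     (forall t, t <= t0 -> - kappa <= v t <= kappa) ->
     \forall t \ae (@lebesgue_measure R),
       t0 <= t -> f v t * Num.sg (v t) <= q t (supnorm v))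
  (gamma : R -> R) (gamma_AC : ACloc `]-oo, t0] gamma)
  (gamma_gt0 : forall t, t <= t0 -> 0 < gamma t)
  (gamma_deriv : \forall t \ae (@lebesgue_measure R), t <= t0 ->
     derivable gamma (t : R) (1 : R) /\ derive1 gamma t <= - l1 (theta t0 gamma) t)
  (l0_ge : \forall t \ae (@lebesgue_measure R), t <= t0 ->
     l1 (theta t0 gamma) t / gamma t <= l0 (cst 1) t)
  (Msigma_fin : (Msigma t0 sigma l1 gamma < +oo)%E)
  (g : R -> R) (g_Lloc : Lloc_nonneg g)
  (h0 : R -> R)
  (h0_gt0 : forall x, 0 < x -> 0 < h0 x)
  (h0_cont : {within `]0, +oo[, continuous h0})
  (h0_nondecreasing : forall x y : R, 0 < x -> x <= y -> h0 x <= h0 y)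
  (f_le_g : forall v : R -> R, C0 `[0, kappa] v -> (exists t, v t != 0) ->
     \forall t \ae (@lebesgue_measure R), t <= t0 ->
       f v t <= g t * h0 (supnorm v))
  (h0_osgood :
     (\int[@lebesgue_measure R]_(s in `[x, 1%R]) ((h0 s)^-1)%:E)%E
       @[x --> (0 : R)^'+] --> +oo%E) :
  forall c : R, 0 < c -> c <= kappa * expR (- fine (Msigma t0 sigma l1 gamma)) ->
    exists u : R -> R,
      [/\ global_solution l0 l1 f u,
          u t0 = c &
          forall t, t <= t0 -> 0 < u t /\ u t <= kappa].
Proof.
move=> c c_gt0 c_le.
pose gam := theta t0 gamma.
have gam_cont : continuous gam by exact: continuous_theta_AC.
have gam_gt0 t : 0 < gam t by apply: gamma_gt0; rewrite ge_min lexx orbT.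
have Ll1 : locally_integrable [set: R] (l1 gam) by exact: V_Lloc.
have gam_le x y : x <= y -> y <= t0 -> gam y - gam x <= - inta (l1 gam) x y.
  move=> xy yt0.
  have LNl1 := locally_integrableN Ll1.
  rewrite /gam !theta_le//; last exact: le_trans xy yt0.
  rewrite -[X in _ <= X](_ : inta (fun t => -1 * l1 gam t) x y = _); last first.
    by rewrite intaZ// mulN1r.
  rewrite (@eq_inta _ _ (fun t => - l1 gam t)); last by move=> t _ _; rewrite mulN1r.
  apply: (AC_derive1_le xy LNl1).
    apply: gamma_AC => // t /=; rewrite !in_itv /= => /andP[_ ty].
    exact: le_trans ty yt0.
  by apply: aeS gamma_deriv => t h xt ty; apply: h; exact: ltW (lt_le_trans ty yt0).
pose p s := l1 gam s / gam s.
have p_le : \forall t \ae @lebesgue_measure R, t <= t0 -> p t <= l0 (cst 1) t.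
  by apply: aeS l0_ge => t h tt0; rewrite /p {2}/gam theta_le// h.
have Lp : locally_integrable [set: R] p.
  by apply: LlocM => // t; apply: cvgV; [rewrite gt_eqF|exact: gam_cont].
have p_M t : t <= t0 -> inta p (sigma t) t <= fine (Msigma t0 sigma l1 gamma).
  move=> tt0.
  have pM : ((inta p (sigma t) t)%:E <= Msigma t0 sigma l1 gamma)%E.
    apply: ereal_sup_ubound; exists t; first by rewrite /= in_itv.
    rewrite /inta /Rintegral fineK; last exact: integrable_fin_num (Lloc_integrable _ _ Lp).
    apply: eq_integral => s; rewrite inE /= in_itv /= => /andP[_ st].
    by rewrite /p {2}/gam theta_le// (le_trans st).
  (* [fine] sends infinite values to 0, so finiteness is checked: the upper side is assumed, and the
     integral at [t] bounds the supremum from below. *)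
  have Mfin : Msigma t0 sigma l1 gamma \is a fin_num.
    by rewrite fin_numElt Msigma_fin andbT; apply: lt_le_trans pM; exact: ltNyr.
  by rewrite -lee_fin (fineK Mfin).
have [v [v_cont v01 v_t0 v_eq v_ratio]] :=
  left_global l0_lin l0_pos l1_lin l1_pos f_car l0_V l1_V f_V sigma_Sigma l0_Vsigma f_zero
    kappa_gt0 f_ge0 gam_cont gam_gt0 gam_le p_le p_M c_gt0 c_le.
have v_gt0 := osgood_positive l0_lin l0_pos l1_pos l0_V l1_V f_V g_Lloc h0_gt0 h0_cont
  h0_nondecreasing f_le_g h0_osgood gam_gt0 c_gt0 v_cont v01 v_t0 v_eq v_ratio.
have [u [u_cont uv u_eq]] := right_global l0_lin l0_pos l1_lin l1_pos f_car l0_V l1_V f_V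
  kappa_gt0 q_Kloc q_nondecreasing q_sublinear f_le_q v_cont (fun t _ => v01 t).
have u_left x y : x <= y -> y <= t0 ->
    u y - u x = inta (fun t => l0 u t - l1 u t + f u t) x y.
  move=> xy yt0; rewrite !uv ?(le_trans xy)// v_eq//.
  by apply: rhs_inta_eq => // s sy; rewrite uv// (le_trans sy).
exists u; split.
- apply: integral_global_solution => // x y xy.
  have [yt0|/ltW ty] := leP y t0; first exact: u_left.
  have [xt0|/ltW tx] := leP x t0; last exact: u_eq.
  rewrite (inta_chasles (rhs_Lloc l0_V l1_V f_V u_cont) xt0 ty).
  rewrite -(u_left _ _ xt0 (lexx t0)) -(u_eq _ _ (lexx t0) ty); ring.
- by rewrite uv.
- by move=> t tt0; rewrite uv//; have /andP[_ vk] := v01 t; split => //; exact: v_gt0.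
Qed.
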